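(* For each $n$ let $\pi_n$ be a uniformly random parking function of length $n$, and let $K_n(\pi_n)$ be its number of cycles. Then the family $\left\{\frac{K_n(\pi_n)}{\log n}\right\}_{n\ge2}$ satisfies a large deviation principle (on $\mathbb R$, as $n\to\infty$) with speed $\log n$ and rate function $$I(x)=\begin{cases} x\log(2x)-x+\frac12 & x\ge0,\\ \infty & x<0,\end{cases}$$ with the convention $0\log 0=0$.
   Context: Let $[n]=\{1,\dots,n\}$. A parking function of length $n$ is a sequence $\pi_n=(\pi_n(1),\dots,\pi_n(n))\in[n]^n$ such that $|\{k\in[n]:\pi_n(k)\le i\}|\ge i$ for all $i\in[n]$. Viewing $\pi_n$ as a map $[n]\to[n]$, its digraph $G_{\pi_n}$ is the directed graph with vertex set $[n]$ and a directed edge from $i$ to $\pi_n(i)$ for every $i\in[n]$. The number of cycles $K_n(\pi_n)$ is the number of directed cycles in $G_{\pi_n}$ (a fixed point gives a self-loop, which counts as a cycle of length $1$). A family of real random variables $\{X_n\}$ satisfies a large deviation principle with speed $a_n\to\infty$ and (lower semicontinuous) rate function $I:\mathbb R\to[0,\infty]$ if for every Borel set $B\subseteq\mathbb R$, $-\inf_{x\in B^\circ}I(x)\le\liminf_{n\to\infty}\frac1{a_n}\log \mathrm P(X_n\in B)\le\limsup_{n\to\infty}\frac1{a_n}\log \mathrm P(X_n\in B)\le-\inf_{x\in\overline B}I(x)$, where $B^\circ$ and $\overline B$ are the interior and closure of $B$. *)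

(* Defs.v *)
From HB Require Import structures.
From mathcomp Require Import all_boot all_order all_algebra.
From mathcomp Require Import all_classical all_reals all_analysis.

Set Implicit Arguments.
Unset Strict Implicit.
Unset Printing Implicit Defensive.

Import Order.TTheory GRing.Theory Num.Theory.
Import numFieldNormedType.Exports.

Local Open Scope classical_set_scope.
Local Open Scope ring_scope.

(* A directed cycle of the digraph with edge relation [e] is a subgraph,
   represented by its set of arcs: the closed walks obtained from one another
   by rotation are the same cycle, and a loop at [x] is the cycle
   {(x, x)} of length 1. *)
Section DirectedCycles.
Variable T : finType.

Definition cycle_arcs (c : seq T) : {set T * T} :=
  [set:: [seq (x, next c x) | x <- c]]%SET.

Definition dicycle (e : rel T) (E : {set T * T}) : Prop :=
  exists c : seq T, [/\ c != [::], ucycle e c & E = cycle_arcs c].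

Definition num_dicycles (e : rel T) : nat :=
  #|[pred E : {set T * T} | `[< dicycle e E >]]|.

End DirectedCycles.

(* The element [i] of ['I_n] stands for [i + 1] in [{1, ..., n}]. *)
Definition is_parking (n : nat) (f : {ffun 'I_n -> 'I_n}) : bool :=
  [forall i : 'I_n, (i.+1 <= #|[pred k : 'I_n | (f k <= i)%N]|)%N].

Record parking (n : nat) : Type := Parking {
  parking_fun :> {ffun 'I_n -> 'I_n};
  parkingP : is_parking parking_fun
}.

HB.instance Definition _ (n : nat) := [isSub for @parking_fun n].
HB.instance Definition _ (n : nat) := [Finite of parking n by <:].

Lemma is_parking_id (n : nat) : is_parking [ffun i : 'I_n => i].
Proof.
apply/forallP => i.
rewrite -sum1_card (eq_bigl (fun k : 'I_n => (k < i.+1)%N)); last first.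
  by move=> k; rewrite inE ffunE ltnS.
by rewrite (big_ord_narrow (ltn_ord i)) sum1_card card_ord.
Qed.

HB.instance Definition _ (n : nat) :=
  isPointed.Build (parking n) (Parking (is_parking_id n)).
HB.instance Definition _ (n : nat) :=
  @isMeasurable.Build default_measure_display (parking n)
    discrete_measurable discrete_measurable0
    discrete_measurableC discrete_measurableU.

(* [frel f] relates [x] to [y] when [f x = y]. *)
Definition parking_cycles (n : nat) (p : parking n) : nat :=
  num_dicycles (frel p).

(* For [n < 2], [ln n = 0] and the quotient is the junk value 0; only the limit
   [n --> oo] is ever taken. *)
Definition cycles_over_log (R : realType) (n : nat) (p : parking n) : R :=
  (parking_cycles p)%:R / ln n%:R.

Lemma measurable_cycles_over_log (R : realType) (n : nat) :
  measurable_fun [set: parking n] (@cycles_over_log R n).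
Proof. by []. Qed.

HB.instance Definition _ (R : realType) (n : nat) :=
  isMeasurableFun.Build _ _ _ _ (@cycles_over_log R n)
    (@measurable_cycles_over_log R n).

Definition uniform_parking (R : realType) (d : measure_display)
    (T : measurableType d) (P : probability T R) (n : nat)
    (X : {RV P >-> parking n}) : Prop :=
  forall p : parking n, P (X @^-1` [set p]) = (#|{: parking n}|%:R^-1)%:E.

(* The convention log 0 = -oo is that of [lne]. *)
Definition large_deviation_principle (R : realType) (d : nat -> measure_display)
    (T : forall n, measurableType (d n)) (P : forall n, probability (T n) R)
    (X : forall n, {RV P n >-> R}) (a : nat -> R) (I : R -> \bar R) : Prop :=
  [/\ a n @[n --> \oo] --> +oo,
      (forall x, (0 <= I x)%E),
      lower_semicontinuous I &
      forall B : set R, measurable B ->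
        let u n := ((a n)^-1%:E * lne (P n (X n @^-1` B)))%E in
        (- ereal_inf (I @` interior B) <= limn_einf u /\
         limn_einf u <= limn_esup u /\
         limn_esup u <= - ereal_inf (I @` closure B))%E].

(* At [x = 0] the convention 0 log 0 = 0 holds since [ln 0 = 0]. *)
Definition cycle_rate (R : realType) (x : R) : \bar R :=
  if 0 <= x then (x * ln (2 * x) - x + 2^-1)%:E else +oo%E.

(* Main.v *)
Require Import Defs.
From HB Require Import structures.
From mathcomp Require Import all_boot all_order all_algebra all_fingroup.
From mathcomp Require Import zify ring lra.
From mathcomp Require Import all_classical all_reals all_analysis.

Set Implicit Arguments.
Unset Strict Implicit.
Unset Printing Implicit Defensive.

Import Order.TTheory GRing.Theory Num.Theory.
Import numFieldNormedType.Exports.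

(** The number of cycles [K] of a random parking function behaves like a Poisson
    variable of parameter [ln n / 2], and the rate function is the one of such a
    variable divided by [ln n]. The proof computes the exponential moments of [K]
    exactly, estimates them up to constant factors, and transfers the estimate to
    probabilities by exponential tilting.

    Exact formula. For a self-map [f], expanding [(1 + y) ^ K] by the binomial
    formula gives a sum over the sets [S] with [f @: S = S] of [y] to the number of
    cycles in [S] ([expr_num_dicycles]). Being a parking function does not depend on
    the order of the cars, so on [S] such a map acts as a uniform permutation, and
    the sum over the permutations of [m] points is the rising factorial
    [y (y + 1) ... (y + m - 1)] ([sum_perm_on_orbits]). What is left is to count
    parking functions that are injective on [m] given cars
    ([sum_num_dicycles_inj]). Injectivity is invariant under rotation of a circle of
    [n + 1] spots, so Pollak's argument ([card_parks]) makes this count proportional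
    to the one for arbitrary maps into [n + 1] points. Hence
    [mean_expr_parking_cycles]: the mean of [(1 + y) ^ K] is the sum over [m <= n] of
    [rising y m / m`!] times the probability that [m] uniform points among [n + 1]
    are distinct.

    Growth. The factor [rising y m / m`!] is the increment of [perm_pgf y], a sequence
    of order [m ^ y], while the probabilities decay around [m = sqrt n]. Summation by
    parts ([partial_mean_parts]) gives the mean the order [n ^ (y / 2)]
    ([ln_partial_mean]): with [1 + y = expR t], the logarithm of the mean of
    [expR (t * K)] is [(expR t - 1) / 2 * ln n] up to a bounded error
    ([ln_cycle_mgf]).

    Large deviations. The rate is the Legendre transform of [(expR t - 1) / 2]
    ([young]). The upper bound is Chernoff's inequality on the two sides of [1/2]
    ([near_prob_in_closed]); the lower bound tilts the law so that the point under
    consideration becomes typical ([near_prob_ge]). *)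

(** * Finite sets *)

Section FiniteSets.
Import mathcomp.boot.fintype mathcomp.boot.finset.
Local Open Scope ring_scope.

Lemma sum_powerset (I : finType) (A : {set I}) (R : comNzRingType) (y : R) :
  \sum_(B : {set I} | B \subset A) y ^+ #|B| = (1 + y) ^+ #|A|.
Proof.
rewrite -[RHS]prodr_const [RHS]big_mkcond /=.
rewrite [RHS](eq_bigr (fun i => (if i \in A then y else 0) + 1)); last first.
  by move=> i _; case: ifP => _; rewrite ?add0r // addrC.
rewrite bigA_distr big_mkcond /=; apply: eq_bigr => B _.
rewrite -big_mkcond /=; case: ifPn => [/subsetP sBA|/subsetPn[i iB iA]].
  rewrite -prodr_const; apply: eq_bigr => i iB.
  by rewrite sBA.
by rewrite (bigD1 i) //= (negbTE iA) mul0r.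
Qed.

Lemma exists_set_card (I : finType) (m : nat) : (m <= #|I|)%N ->
  exists A : {set I}, #|A| = m.
Proof.
move=> mI; exists [set x in take m (enum I)]%SET; rewrite cardsE.
rewrite (card_uniqP _) ?take_uniq ?enum_uniq // size_take -cardE.
by case: ltnP => // le; apply/eqP; rewrite eqn_leq le mI.
Qed.

(** Listing a set before its complement, for both sets, and matching the two
    lists position by position gives a permutation. *)
Lemma perm_imset (T : finType) (S D : {set T}) :
  #|S| = #|D| -> exists s : {perm T}, s @: S = D.
Proof.
move=> cSD; have cCSD : #|~: S| = #|~: D|.
  by apply/eqP; rewrite -(eqn_add2l #|S|) cardsC cSD cardsC.
pose sq (A : {set T}) := enum A ++ enum (~: A).
have msq A x : x \in sq A by rewrite mem_cat !mem_enum inE orbN.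
have usq A : uniq (sq A).
  rewrite cat_uniq !enum_uniq /= andbT; apply/hasPn => x.
  by rewrite !mem_enum inE.
have ssq : size (sq S) = size (sq D) by rewrite !size_cat -!cardE cSD cCSD.
pose g x := nth x (sq D) (index x (sq S)).
have lt x : (index x (sq S) < size (sq D))%N by rewrite -ssq index_mem.
have injg : injective g.
  move=> x y; rewrite /g (set_nth_default x y) // => /eqP.
  rewrite nth_uniq // => /eqP /(congr1 (nth x (sq S))).
  by rewrite !nth_index.
exists (perm injg); apply/eqP; rewrite eqEcard card_imset ?cSD ?leqnn ?andbT; last exact: perm_inj.
apply/subsetP => _ /imsetP[x xS ->]; rewrite permE /g.
have xE : x \in enum S by rewrite mem_enum.
rewrite index_cat xE nth_cat -!cardE -cSD [#|S|]cardE index_mem xE.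
by rewrite -mem_enum mem_nth // -cardE -cSD cardE index_mem.
Qed.

End FiniteSets.

(** * Cycles of a self-map *)

Section Cycles.
Import mathcomp.boot.fintype mathcomp.boot.finset.
Variables (T : finType) (f : T -> T).
Implicit Types (x y : T) (S : {set T}).

(** On the cycle through [x] this is the vertex set of that cycle; away from the
    cycles it is only a forward orbit. *)
Definition forbit x : {set T} := [set y | fconnect f x y]%SET.
Definition orbits S : {set {set T}} := [set forbit x | x in S]%SET.
Definition cyclic_points : {set T} := [set x | fconnect f (f x) x]%SET.

Lemma forbit_id x : x \in forbit x.
Proof. by rewrite inE connect0. Qed.

Lemma forbit_cyclic x y : x \in cyclic_points -> y \in forbit x ->
  (y \in cyclic_points) /\ forbit y = forbit x.
Proof.
rewrite inE fconnect_f => cx; rewrite inE => xy.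
have yo : y \in fingraph.orbit f x by rewrite -fconnect_orbit.
have E z : fconnect f y z = (z \in fingraph.orbit f x) by apply: fconnect_cycle.
split; last by apply/setP => z; rewrite !inE E fconnect_orbit.
have fyo : f y \in fingraph.orbit f x by rewrite -E fconnect1.
by rewrite inE (fconnect_cycle cx fyo).
Qed.

Lemma cyclic_step x : x \in cyclic_points -> exists2 y, y \in forbit x & f y = x.
Proof.
rewrite inE => cx; have [k] := (orbitPcycle 2 3).1 cx.
by rewrite iterS => e; exists (iter k f x) => //; rewrite inE fconnect_iter.
Qed.

Lemma stable_forbit S x : f @: S = S -> x \in S -> forbit x \subset S.
Proof.
move=> fS xS; apply/subsetP => y; rewrite inE => /iter_findex <-.
by elim: (findex _ _ _) => //= k IH; rewrite -fS imset_f.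
Qed.

Lemma stable_cyclic S : f @: S = S -> S \subset cyclic_points.
Proof.
move=> fS; apply/subsetP => x xS; rewrite inE.
have /imset_injP injS : #|f @: S| == #|S| by rewrite fS.
apply/(orbitPcycle 2 5) => y z; rewrite -!fconnect_orbit => xy xz.
have s := subsetP (stable_forbit fS xS).
by apply: injS; apply: s; rewrite inE.
Qed.

Lemma cover_orbits S : f @: S = S -> cover (orbits S) = S.
Proof.
move=> fS; rewrite cover_imset; apply/setP => x; apply/bigcupP/idP.
  by move=> [y yS] /(subsetP (stable_forbit fS yS)).
by exists x => //; exact: forbit_id.
Qed.

Lemma cover_stable (A : {set {set T}}) : A \subset orbits cyclic_points ->
  f @: cover A = cover A.
Proof.
move=> /subsetP sA; apply/setP => x; apply/imsetP/bigcupP.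
  move=> [y /bigcupP[Z OA yO] ->]; exists Z => //.
  have /imsetP[z cz eO] := sA _ OA; rewrite eO in yO *.
  by move: yO; rewrite !inE => /connect_trans; apply; exact: fconnect1.
move=> [Z OA xO]; have /imsetP[z cz eO] := sA _ OA.
rewrite eO in xO; have [cx exz] := forbit_cyclic cz xO.
have [y yx <-] := cyclic_step cx; exists y => //.
by apply/bigcupP; exists Z => //; rewrite eO -exz.
Qed.

Lemma orbits_cover (A : {set {set T}}) : A \subset orbits cyclic_points ->
  orbits (cover A) = A.
Proof.
move=> /subsetP sA; apply/setP => Z; apply/imsetP/idP.
  move=> [x /bigcupP[Z' OA xO] ->]; have /imsetP[z cz eO] := sA _ OA.
  by rewrite eO in xO OA; have [_ ->] := forbit_cyclic cz xO.
move=> OA; have /imsetP[z cz eO] := sA _ OA; exists z => //.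
by apply/bigcupP; exists Z => //; rewrite eO forbit_id.
Qed.

(** A cycle of a functional digraph is determined by its vertices, its arcs being
    the pairs [(y, f y)]. *)
Lemma dicycleP (E : {set T * T}) : dicycle (frel f) E <->
  exists2 x, x \in cyclic_points & E = [set (y, f y) | y in forbit x]%SET.
Proof.
split=> [[[|x c] [//_ /andP[cc uc] ->]]|[x cx ->]].
  have xc : x \in x :: c by rewrite mem_head.
  have xcE y : fconnect f x y = (y \in x :: c) by apply: fconnect_cycle.
  exists x; first by rewrite inE (fconnect_cycle cc) // -xcE fconnect1.
  apply/setP => -[a b]; rewrite inE; apply/mapP/imsetP => -[y yc [-> ->]].
    by exists y; [rewrite inE xcE|rewrite -(nextE cc yc)].
  by move: yc; rewrite inE xcE => yc; exists y; [|rewrite (nextE cc)].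
move: cx; rewrite inE fconnect_f => cx; exists (fingraph.orbit f x); split.
- by apply/eqP => e; have := in_orbit f x; rewrite e.
- by rewrite /ucycle cx orbit_uniq.
- apply/setP => -[a b]; rewrite inE; apply/imsetP/mapP => -[y yc [-> ->]].
    move: yc; rewrite inE fconnect_orbit => yc.
    by exists y; [|rewrite (nextE cx)].
  by exists y; [rewrite inE fconnect_orbit|rewrite (nextE cx)].
Qed.

Lemma num_dicyclesE : num_dicycles (frel f) = #|orbits cyclic_points|.
Proof.
pose G (Z : {set T}) : {set T * T} := [set (y, f y) | y in Z]%SET.
have injG : injective G.
  move=> Z Z' e; apply/setP => x.
  have H (A : {set T}) : (x \in A) = ((x, f x) \in G A).
    by apply/idP/imsetP => [xA|[y yA [-> _]]//]; exists x.
  by rewrite !H e.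
rewrite -(card_imset _ injG); apply: eq_card => E; rewrite !inE.
apply/asboolP/imsetP.
  by move=> /dicycleP[x cx ->]; exists (forbit x) => //; exact: imset_f.
by move=> [Z /imsetP[x cx ->] ->]; apply/dicycleP; exists x.
Qed.

Local Open Scope ring_scope.

(** Expanding the power by the binomial formula sums over sets of cycles, and a
    set of cycles is the same thing as a set of points that [f] maps onto itself. *)
Lemma expr_num_dicycles (R : comNzRingType) (y : R) :
  (1 + y) ^+ num_dicycles (frel f) =
  \sum_(S : {set T} | f @: S == S) y ^+ #|orbits S|.
Proof.
rewrite num_dicyclesE -sum_powerset.
rewrite (reindex_onto orbits cover) /=; last by move=> A; exact: orbits_cover.
apply: eq_bigl => S; apply/andP/eqP => [[sS /eqP<-]|fS].
  exact: cover_stable.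
by rewrite imsetS ?stable_cyclic// cover_orbits.
Qed.
End Cycles.

(** * Cycles of a random permutation *)

Section Perm.
Import mathcomp.boot.fintype mathcomp.boot.finset.
Local Open Scope ring_scope.
Variable (T : finType).
Implicit Types (s : {perm T}) (S : {set T}).

Lemma eq_orbits_stable (f g : T -> T) S : f @: S = S -> {in S, f =1 g} ->
  orbits f S = orbits g S.
Proof.
move=> fS fg; apply: eq_in_imset => x xS; apply/setP => y; rewrite !inE.
have H k : iter k f x = iter k g x /\ iter k f x \in S.
  elim: k => //= k [IH kS]; rewrite -IH fg //; split => //.
  by rewrite -fg // -fS imset_f.
apply/idP/idP => /iter_findex <-; first by rewrite (H _).1 fconnect_iter.
by rewrite -(H _).1 fconnect_iter.
Qed.

Lemma forbit_porbit s x : forbit s x = porbit s x.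
Proof.
apply/setP => y; rewrite inE; apply/idP/porbitP.
  by move=> /iter_findex <-; eexists; rewrite permX.
by move=> [i ->]; rewrite permX fconnect_iter.
Qed.

(** Outside [S] every point is a cycle of length one. *)
Lemma porbits_perm_on s S : perm_on S s ->
  (#|porbits s| + #|S| = #|orbits s S| + #|T|)%N.
Proof.
move=> onS; suff -> : #|porbits s| = (#|orbits s S| + #|~: S|)%N.
  by rewrite -addnA [X in (_ + X)%N]addnC cardsC.
have <- : #|[set [set x] | x in ~: S]%SET| = #|~: S| by apply: card_imset; exact: set1_inj.
have fixC x : x \notin S -> porbit s x = [set x]%SET.
  move=> xS; apply/setP => y; rewrite inE; apply/porbitP/eqP.
    by move=> [i ->]; rewrite permX_fix // (out_perm onS).
  by move=> ->; exists 0%N; rewrite expg0 perm1.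
have -> : porbits s = orbits s S :|: [set [set x]%SET | x in ~: S]%SET.
  apply/setP => Z; rewrite inE; apply/imsetP/orP => [[x _ ->]|].
    have [xS|xS] := boolP (x \in S); [left|right].
      by rewrite -forbit_porbit imset_f.
    by rewrite fixC // imset_f // inE.
  case=> /imsetP[x xS ->]; exists x => //; first by rewrite forbit_porbit.
  by rewrite fixC //; rewrite inE in xS.
rewrite cardsU disjoint_setI0 ?cards0 ?subn0 1?addnC//.
rewrite -setI_eq0; apply/eqP/setP => Z; rewrite !inE; apply/negP => /andP[].
move=> /imsetP[x xS ->] /imsetP[y yS] /setP/(_ x).
by rewrite forbit_id inE => /esym/eqP e; rewrite inE -e xS in yS.
Qed.

Definition rising (R : pzSemiRingType) (y : R) (m : nat) : R :=
  \prod_(i < m) (y + i%:R).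

(** Fix [x] in [S]. Cutting [x] out of its cycle, that is, composing with the
    transposition of [x] and its preimage [j], leaves a permutation of [S :\ x].
    The number of cycles drops only if [j = x], so [x] contributes
    [y + (#|S| - 1)]. *)
Lemma sum_perm_on_orbits (R : comNzRingType) (y : R) S :
  \sum_(s | perm_on S s) y ^+ #|orbits s S| = rising y #|S|.
Proof.
have [m cS] : exists m, #|S| = m by exists #|S|.
elim: m S cS => [|m IH] S cS.
  move/eqP: cS; rewrite cards_eq0 => /eqP->.
  rewrite (big_pred1 1%g) => [|s].
    by rewrite /orbits imset0 cards0 /rising cards0 big_ord0.
  apply/idP/eqP => [s0|->]; last exact: perm_on1.
  by apply/permP => x; rewrite (out_perm s0) ?inE // perm1.
have [x xS] : exists x, x \in S by apply/card_gt0P; rewrite cS.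
have cS' : #|S :\ x| = m by move: cS; rewrite (cardsD1 x S) xS add1n => -[].
rewrite cS /rising big_ord_recr /= -/(rising y m) -{1}cS' -IH //.
(* [j] is the preimage of [x]. *)
rewrite (partition_big (fun s => (s^-1)%g x) (mem S)) /=; last first.
  by move=> s onS; rewrite perm_closed ?perm_onV.
rewrite (eq_bigr (fun j => y ^+ (x == j) *
   \sum_(s | perm_on (S :\ x) s) y ^+ #|orbits s (S :\ x)|)); last first.
  move=> j jS; rewrite big_distrr /=.
  have onj : perm_on S (tperm x j).
    apply: (fintype.subset_trans (tperm_on x j)).
    by apply/subsetP => z; rewrite !inE => /orP[]/eqP->.
  rewrite (reindex_onto (mulg (tperm x j)) (mulg (tperm x j))) /=; last first.
    by move=> s _; rewrite tpermKg.
  have onE s : (perm_on S (tperm x j * s)%g && ((tperm x j * s)^-1%g x == j)) &&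
     ((tperm x j * (tperm x j * s))%g == s) = perm_on (S :\ x) s.
    rewrite tpermKg eqxx andbT.
    have -> : ((tperm x j * s)^-1%g x == j) = (s x == x).
      rewrite -[_ == j](inj_eq (@perm_inj _ (tperm x j * s)%g)) permKV.
      by rewrite permM tpermR eq_sym.
    have -> : perm_on S (tperm x j * s)%g = perm_on S s.
      apply/idP/idP => [H|]; last exact: perm_onM.
      by rewrite -(tpermKg x j s); exact: perm_onM.
    apply/andP/subsetP => [[/subsetP H /eqP sx] z|H].
      rewrite inE => zs; rewrite !inE H ?inE // andbT.
      by apply: contraNneq zs => ->; rewrite sx.
    split; first by apply/subsetP => z /H; rewrite !inE => /andP[].
    apply/negPn/negP => nsx.
    by have := H x nsx; rewrite !inE eqxx.
  apply: eq_big => s; first exact: onE.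
  rewrite onE => ons; rewrite -exprD; congr (_ ^+ _).
  have onS : perm_on S (tperm x j * s)%g.
    apply: perm_onM => //; apply: (fintype.subset_trans ons).
    by apply/subsetP => z; rewrite !inE => /andP[].
  have := porbits_perm_on ons; have := porbits_perm_on onS.
  have /= := porbits_mul_tperm s x j.
  have -> : (x \in porbit s j) = (x == j).
    rewrite porbit_sym; apply/porbitP/eqP => [[i ->]|->]; last first.
      by exists 0%N; rewrite expg0 perm1.
    by rewrite permX_fix // (out_perm ons) // !inE eqxx.
  by rewrite cS cS'; case: eqVneq => /= _; lia.
rewrite -big_distrl /= mulrC; congr (_ * _).
rewrite (bigD1 x) //= eqxx expr1; congr (_ + _).
rewrite (eq_bigr (fun=> 1)); last by move=> j /andP[_]; rewrite eq_sym => /negbTE ->.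
rewrite sumr_const -cS'; congr (_ *+ _); apply: eq_card => z.
by rewrite !inE andbC.
Qed.
End Perm.

(** * Exchangeable sets of functions *)

Section Exchangeable.
Import mathcomp.boot.fintype mathcomp.boot.finset.
Local Open Scope ring_scope.
Variables (T : finType).
Implicit Types (s : {perm T}) (S D : {set T}) (f : {ffun T -> T}).

Lemma stable_perm (f : T -> T) S : f @: S = S ->
  exists2 s, perm_on S s & {in S, f =1 s}.
Proof.
move=> fS; have injf : {in S &, injective f} by apply/imset_injP; rewrite fS.
have mS x : x \in S -> f x \in S by move=> xS; rewrite -[in X in _ \in X]fS imset_f.
pose g x := if x \in S then f x else x.
have injg : injective g.
  move=> x y; rewrite /g; case: ifPn => xS; case: ifPn => yS //; first exact: injf.
  - by move=> e; rewrite -e mS in yS.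
  - by move=> e; rewrite e mS in xS.
exists (perm injg) => [|x xS]; last by rewrite permE /g xS.
apply/subsetP => x; rewrite inE permE /g.
by case: ifP => //; rewrite eqxx.
Qed.

Variable P : pred {ffun T -> T}.
Hypothesis P_perm : forall f s, P [ffun x => f (s x)] = P f.

Definition num_fixing S := #|[set f | P f & [forall x in S, f x == x]]%SET|.

(** By exchangeability each permutation of [S] is as frequent on [S] as the
    identity. *)
Lemma card_agree S s : perm_on S s ->
  #|[set f | P f & [forall x in S, f x == s x]]%SET| = num_fixing S.
Proof.
move=> onS; pose h f : {ffun T -> T} := [ffun x => f (s^-1%g x)].
have injh : injective h.
  move=> f g /ffunP e; apply/ffunP => x.
  by have := e (s x); rewrite !ffunE permK.
rewrite /num_fixing -[RHS](card_preimset _ injh); apply: eq_card => f.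
rewrite !inE P_perm; congr (_ && _).
apply/'forall_in_eqP/'forall_in_eqP => H x xS.
  by rewrite ffunE H ?perm_closed ?perm_onV // permKV.
by have := H (s x); rewrite perm_closed // ffunE permK => ->.
Qed.

(** Every function that maps [S] onto itself agrees on [S] with exactly one
    permutation of [S], and all these permutations are equally frequent. *)
Lemma sum_stable (R : comNzRingType) (y : R) S :
  \sum_(f | P f && (f @: S == S)) y ^+ #|orbits f S| =
  rising y #|S| * (num_fixing S)%:R.
Proof.
rewrite -sum_perm_on_orbits mulr_suml.
transitivity (\sum_(f | P f && (f @: S == S))
    \sum_(s | perm_on S s && [forall x in S, f x == s x]) y ^+ #|orbits s S|).
  apply: eq_bigr => f /andP[_ /eqP fS]; have [s onS fs] := stable_perm fS.
  rewrite (big_pred1 s) => [|t]; first by rewrite (eq_orbits_stable fS fs).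
  apply/andP/eqP => [[ont /'forall_in_eqP ft]|->]; last first.
    by split=> //; apply/'forall_in_eqP.
  apply/permP => x; have [xS|xS] := boolP (x \in S).
    by rewrite -ft // fs.
  by rewrite !(@out_perm _ S).
rewrite (exchange_big_dep (perm_on S)) /=; last by move=> f s _ /andP[].
apply: eq_bigr => s onS; rewrite sumr_const -[LHS]mulr_natr -(card_agree onS).
congr (_ * _%:R); apply: eq_card => f; rewrite !inE onS /= unfold_in /= -andbA.
congr (_ && _); apply/andP/idP => [[]//|fs]; split=> //.
rewrite -[X in _ == X](im_perm_on onS); apply/eqP/eq_in_imset => x xS.
exact: ('forall_in_eqP fs).
Qed.

Lemma sum_num_dicycles (R : comNzRingType) (y : R) :
  \sum_(f | P f) (1 + y) ^+ num_dicycles (frel f) =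
  \sum_(S : {set T}) rising y #|S| * (num_fixing S)%:R.
Proof.
under eq_bigr do rewrite expr_num_dicycles.
rewrite (exchange_big_dep predT) //=.
by apply: eq_bigr => S _; rewrite -sum_stable.
Qed.

Lemma rising1 (R : pzSemiRingType) m : rising (1 : R) m = m`!%:R.
Proof.
elim: m => [|m IH]; first by rewrite /rising big_ord0.
by rewrite /rising big_ord_recr /= -/(rising 1 m) IH factS mulnC natrM -nat1r.
Qed.

(** A function that is injective on [D] maps [D] onto some [S] of the same size;
    precomposing with a permutation that sends [S] to [D] turns it into a function
    that maps [S] onto itself. *)
Lemma card_inj_on D :
  #|[set f | P f & dinjectiveb f D]%SET| =
  ((#|D|)`! * \sum_(S : {set T} | #|S| == #|D|) num_fixing S)%N.
Proof.
rewrite -sum1_card.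
rewrite (partition_big (fun f => f @: D) (fun S => #|S| == #|D|)) /=; last first.
  by move=> f; rewrite inE => /andP[_ /dinjectiveP/card_in_imset ->].
rewrite big_distrr /=; apply: eq_bigr => S /eqP cS.
(* The case [y = 1] of [sum_stable] counts the functions mapping [S] onto [S]. *)
apply/eqP; rewrite -eqz_nat -!natz natrM -cS -rising1 -sum_stable.
rewrite natr_sum; apply/eqP; have [t tS] := perm_imset cS.
pose h (u : {perm T}) f : {ffun T -> T} := [ffun x => f (u x)].
have hK u : cancel (h u) (h u^-1%g).
  by move=> f; apply/ffunP => x; rewrite !ffunE permKV.
have hKV u : cancel (h u^-1%g) (h u).
  by move=> f; apply/ffunP => x; rewrite !ffunE permK.
rewrite (reindex (h t^-1%g)) /=; last by exists (h t) => f _; [exact: hKV|exact: hK].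
have imD f : h t^-1%g f @: D = f @: S.
  by rewrite -tS -imset_comp; apply: eq_imset => x /=; rewrite ffunE permK.
apply: eq_big => [f|f _]; last by rewrite expr1n.
rewrite !inE P_perm -andbA imD; congr (_ && _).
apply/andP/idP => [[]//|/eqP fS]; split; last by rewrite fS.
by apply/dinjectiveP/imset_injP; rewrite imD fS cS.
Qed.

(** [rising y m / m`!] is the sum over the permutations of [m] points, divided by
    their number; [I m] collects all images of a fixed set of [m] points. *)
Lemma sum_num_dicycles_inj (R : numFieldType) (y : R) (I : nat -> nat) :
  (forall D, #|[set f | P f & dinjectiveb f D]%SET| = I #|D|) ->
  \sum_(f | P f) (1 + y) ^+ num_dicycles (frel f) =
  \sum_(m < #|T|.+1) rising y m / m`!%:R * (I m)%:R.
Proof.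
move=> hI; rewrite sum_num_dicycles.
rewrite (partition_big (fun S : {set T} => inord #|S| : 'I_(#|T|.+1)) predT) //=.
apply: eq_bigr => m _.
have mE S : (inord #|S| == m) = (#|S| == m).
  by rewrite -val_eqE /= inordK // ltnS max_card.
rewrite (eq_bigl _ _ mE) (eq_bigr (fun S => rising y m * (num_fixing S)%:R)); last first.
  by move=> S /eqP ->.
rewrite -mulr_sumr -natr_sum -mulrA; congr (_ * _).
have [D cD] := @exists_set_card T m (ltn_ord m : (m <= #|T|)%N).
have := hI D; rewrite card_inj_on cD => <-.
rewrite natrM mulKf // pnatr_eq0 -lt0n fact_gt0 //.
Qed.
End Exchangeable.

(** * Pollak's circle argument *)

Section Circle.
Import mathcomp.boot.fintype mathcomp.boot.finset.
Local Open Scope nat_scope.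
Variable n : nat.
Implicit Types (g : {ffun 'I_n -> 'I_n.+1}) (c : 'I_n.+1).

(** Preferences for [n.+1] spots under which all [n] cars park and the last spot
    stays empty. *)
Definition parks g := [forall i : 'I_n, i < #|[pred k | g k <= i]|].
Definition rotate c g : {ffun 'I_n -> 'I_n.+1} := [ffun k => (g k - c)%R].
Definition below g j := #|[pred k | g k < j]|.

Lemma val_subZp (x c : 'I_n.+1) :
  (x - c)%R = (if c <= x then x - c else x + n.+1 - c) :> nat.
Proof.
rewrite /= modnDmr; have := ltn_ord x; have := ltn_ord c => hc hx; case: leqP => h.
  have -> : x + (n.+1 - c) = (x - c) + n.+1 by lia.
  by rewrite modnDr modn_small //; lia.
by rewrite modn_small; lia.
Qed.

Lemma belowD g j j' : j <= j' ->
  below g j + #|[pred k | j <= g k < j']| = below g j'.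
Proof.
move=> jj'; rewrite /below -!sum1_card.
rewrite [RHS](bigID (fun k => g k < j)) /=; congr (_ + _); apply: eq_bigl => k.
  by rewrite !inE; case: ltnP => h; rewrite ?andbF // andbT; lia.
by rewrite !inE -leqNgt andbC.
Qed.

Lemma below_max g : below g n.+1 = n.
Proof.
rewrite /below -[RHS]card_ord; apply: eq_card => k.
by rewrite !inE ltn_ord.
Qed.

(** The minimality of [below g c - c], stated without subtraction. *)
Definition leftmost_min g c := [forall j : 'I_n.+1,
  if j < c then below g c + j < below g j + c else below g c + j <= below g j + c].

(** Parking after the rotation by [c] says that the walk [j |-> below g j - j],
    started at [c] and wrapped around the circle, does not go below its initial
    value before the last step. Its total increment is [-1], so the values before
    [c] have to be strictly larger. *)
Lemma parks_rotate g c : parks (rotate c g) = leftmost_min g c.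
Proof.
have cnt i : i < n -> #|[pred k | rotate c g k <= i]| =
    if c + i.+1 < n.+1 then below g (c + i.+1) - below g c
    else n - below g c + below g (c + i.+1 - n.+1).
  move=> lin; case: ltnP => h.
    rewrite -(@belowD g c (c + i.+1)) ?leq_addr // addKn.
    apply: eq_card => k; rewrite !inE ffunE val_subZp.
    by have := ltn_ord (g k); case: (leqP c (g k)) => h' h2 /=; apply/idP/idP; lia.
  have -> : n - below g c = #|[pred k | c <= g k < n.+1]|.
    by rewrite -[X in X - _](below_max g) -(@belowD g c n.+1) ?addKn // ltnW.
  rewrite /below -!sum1_card.
  rewrite (bigID (fun k => c <= g k)) /=; congr (_ + _); apply: eq_bigl => k;
    rewrite !inE ffunE val_subZp; have := ltn_ord (g k); have := ltn_ord c;
    case: (leqP c (g k)) => h' h2 h3; rewrite ?andbT ?andbF //=; apply/idP/idP; lia.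
have bnd j : j <= n.+1 -> below g j <= n.
  by move=> jn; rewrite -[X in _ <= X](below_max g) -(@belowD g j n.+1) ?leq_addr.
have bc := bnd c (ltnW (ltn_ord c)).
apply/forallP/forallP => [H j|H i].
  have hj := ltn_ord j; have hc := ltn_ord c; case: ltnP => jc.
    have li : j + n - c < n by lia.
    have := H (Ordinal li); rewrite cnt //= ifF; last by lia.
    have -> : c + (j + n - c).+1 - n.+1 = j by lia.
    by lia.
  have [->//|cj] := eqVneq (j : nat) c.
  have li : j - c.+1 < n by lia.
  have := H (Ordinal li); rewrite cnt //=; have -> : c + (j - c.+1).+1 = j by lia.
  by rewrite hj; lia.
have li := ltn_ord i; have hc := ltn_ord c.
rewrite cnt //; case: (ltnP (c + i.+1) n.+1) => h.
  by have := H (Ordinal h); rewrite /= ifF; lia.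
have lj : c + i.+1 - n.+1 < n.+1 by lia.
by have := H (Ordinal lj); rewrite /= ifT; lia.
Qed.

Lemma leftmost_min_unique g : #|leftmost_min g| = 1.
Proof.
(* Lexicographic order: first the height of the walk, then the position. *)
pose F (c : 'I_n.+1) := (below g c + (n.+1 - c)) * n.+1 + c.
have [c _ cmin] := @arg_minnP _ ord0 predT F isT.
have gc : leftmost_min g c.
  apply/forallP => j; have := cmin j isT; rewrite /F.
  have hj := ltn_ord j; have hc := ltn_ord c => h.
  case: ltnP => jc.
    have : below g c + (n.+1 - c) < below g j + (n.+1 - j) by nia.
    by lia.
  have : below g c + (n.+1 - c) <= below g j + (n.+1 - j) by nia.
  by lia.
rewrite -(card1 c); apply: eq_card => c'; rewrite !inE; apply/idP/eqP => [gc'|->//].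
apply/val_inj/eqP; have := forallP gc c'; have := forallP gc' c.
by case: (ltngtP c' c) => // h; lia.
Qed.

(** Pollak's argument: among the [n.+1] rotations of a preference function on a
    circle of [n.+1] spots, exactly one leaves the last spot empty. *)
Lemma card_parks (Q : pred {ffun 'I_n -> 'I_n.+1}) :
  (forall c g, Q (rotate c g) = Q g) ->
  #|[set g | parks g & Q g]%SET| * n.+1 = #|[set g | Q g]%SET|.
Proof.
move=> Qrot; rewrite -[RHS]sum1_card.
transitivity (\sum_(g in [set g | Q g]%SET) \sum_(c | parks (rotate c g)) 1).
  rewrite (exchange_big_dep predT) //= -[X in _ * X]card_ord mulnC -sum_nat_const.
  apply: eq_bigr => c _; rewrite sum1dep_card.
  have injr : injective (rotate c).
    by move=> g g' /ffunP e; apply/ffunP => k; have := e k; rewrite !ffunE => /addIr.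
  rewrite -[LHS](card_preimset _ injr); apply: eq_card => g.
  by rewrite !inE Qrot andbC.
apply: eq_bigr => g _; rewrite sum1dep_card -(leftmost_min_unique g).
by apply: eq_card => c; rewrite inE parks_rotate.
Qed.

Lemma card_ffun_inj_on (rT : finType) (D : {set 'I_n}) :
  #|[set g : {ffun 'I_n -> rT} | dinjectiveb g D]%SET| =
  #|rT| ^_ #|D| * #|rT| ^ (n - #|D|).
Proof.
pose U := {x : 'I_n | x \in D}.
pose r (g : {ffun 'I_n -> rT}) : {ffun U -> rT} := [ffun u => g (val u)].
have rinj (g : {ffun _ -> rT}) : dinjectiveb g D = injectiveb (r g).
  apply/dinjectiveP/injectiveP => [H u v|H x y xD yD e].
    by rewrite !ffunE => /(H _ _ (valP u) (valP v))/val_inj.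
  suff /(congr1 val) : (exist _ x xD : U) = exist _ y yD by [].
  by apply: H; rewrite !ffunE.
have cU : #|{: U}| = #|D| by rewrite card_sig; apply: eq_card.
rewrite -cU -card_inj_ffuns cU -sum_nat_const -sum1_card.
rewrite (partition_big r (mem [set e : {ffun U -> rT} | injectiveb e]%SET)) /=; last first.
  by move=> g; rewrite !inE rinj.
apply: eq_bigr => e; rewrite inE => inje; rewrite sum1dep_card.
pose F (x : 'I_n) : pred rT := if insub x is Some u then pred1 (e u) else predT.
have -> : #|[set g | (g \in [set g : {ffun 'I_n -> rT} | dinjectiveb g D]) &&
    (r g == e)]%SET| = #|family F|.
  apply: eq_card => g; rewrite !inE rinj; apply/andP/familyP => [[_ /eqP re] x|H].
    by rewrite /F; case: insubP => [u _ <-|//]; rewrite !inE -re ffunE.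
  have re : r g = e.
    apply/ffunP => u; have := H (val u); rewrite /F valK !inE ffunE => /eqP //.
  by rewrite re eqxx.
rewrite card_family foldrE big_map big_enum /=.
rewrite (bigID (mem D)) /= big1 ?mul1n => [|x xD]; last first.
  by rewrite /F insubT card1.
rewrite (eq_bigr (fun=> #|rT|)) => [|x xD]; last by rewrite /F insubN.
rewrite prod_nat_const; congr (_ ^ _).
by have := cardC (mem D); rewrite card_ord => cD; rewrite -[X in X - _]cD addKn; apply: eq_card.
Qed.

(** Injectivity on [D] is invariant under rotation. *)
Lemma card_parking_inj_on (D : {set 'I_n}) :
  #|[set f : {ffun 'I_n -> 'I_n} | is_parking f & dinjectiveb f D]%SET| * n.+1 =
  n.+1 ^_ #|D| * n.+1 ^ (n - #|D|).
Proof.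
rewrite -[n.+1 in RHS]card_ord -card_ffun_inj_on -card_parks; last first.
  move=> c g; apply/dinjectiveP/dinjectiveP => H x y xD yD.
    by move=> e; apply: H => //; rewrite !ffunE e.
  by rewrite !ffunE => /addIr; exact: H.
congr (_ * _); pose w (f : {ffun 'I_n -> 'I_n}) : {ffun 'I_n -> 'I_n.+1} :=
  [ffun k => widen_ord (leqnSn n) (f k)].
have injw : injective w.
  move=> f f' /ffunP e; apply/ffunP => k; apply/val_inj.
  by have := congr1 val (e k); rewrite !ffunE.
rewrite -(card_imset _ injw); apply: eq_card => g; rewrite inE.
apply/imsetP/andP => [[f]|[pg ig]].
  rewrite inE => /andP[/forallP pf /dinjectiveP jf] ->; split.
    apply/forallP => i; apply: leq_trans (pf i) _; apply/eq_leq/eq_card => k.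
    by rewrite !inE ffunE.
  apply/dinjectiveP => x y xD yD /(congr1 val); rewrite !ffunE /= => e.
  by apply: jf => //; exact: val_inj.
have gn k : g k < n.
  have n0 : 0 < n by apply: leq_ltn_trans (ltn_ord k).
  have li : n.-1 < n by rewrite ltn_predL.
  have := forallP pg (Ordinal li); rewrite /= prednK // => H.
  have : k \in [pred k | g k <= n.-1].
    apply/negPn/negP => nk; move: H; rewrite leqNgt => /negP; apply.
    by rewrite -[n in X in _ < X]card_ord; apply/proper_card/properP; split;
      [exact/subsetP|exists k].
  by rewrite inE -ltnS prednK.
exists [ffun k => Ordinal (gn k)]; last first.
  by apply/ffunP => k; apply/val_inj; rewrite !ffunE.
rewrite inE; apply/andP; split.
  apply/forallP => i; apply: leq_trans (forallP pg i) _; apply/eq_leq/eq_card => k.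
  by rewrite !inE ffunE.
apply/dinjectiveP => x y xD yD; rewrite !ffunE => /(congr1 val) /= e.
by apply: (dinjectiveP _ _ ig x y xD yD); exact: val_inj.
Qed.
End Circle.

(** * The probability generating function of the number of cycles *)

Section ParkingMean.
Import mathcomp.boot.fintype mathcomp.boot.finset.
Local Open Scope ring_scope.
Variable n : nat.

Lemma is_parking_perm (f : {ffun 'I_n -> 'I_n}) (s : {perm 'I_n}) :
  is_parking [ffun x => f (s x)] = is_parking f.
Proof.
apply: eq_forallb => i; congr (_ <= _)%N.
transitivity #|s @^-1: [set k | (f k <= i)%N]%SET|.
  by apply: eq_card => k; rewrite !inE ffunE.
by rewrite card_preimset ?cardsE //; exact: perm_inj.
Qed.

Lemma sum_parking (V : nmodType) (F : {ffun 'I_n -> 'I_n} -> V) :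
  \sum_(p : parking n) F (\val p) = \sum_(f | is_parking f) F f.
Proof.
pose p0 := Parking (is_parking_id n).
rewrite [RHS](reindex_onto (@parking_fun n) (insubd p0)) /=; last first.
  by move=> f pf; exact: insubdK.
by apply: eq_bigl => p; rewrite parkingP /= (valKd p0 p) eqxx.
Qed.

(** The last factor is the probability that [m] given points have distinct images
    under a uniform function into [n.+1] points. *)
Lemma mean_expr_parking_cycles (R : numFieldType) (y : R) :
  (\sum_(p : parking n) (1 + y) ^+ parking_cycles p) / #|{: parking n}|%:R =
  \sum_(m < n.+1) rising y m / m`!%:R * ((n.+1 ^_ m)%:R / n.+1%:R ^+ m).
Proof.
pose I m := ((n.+1 ^_ m * n.+1 ^ (n - m)) %/ n.+1)%N.
have hI (D : {set 'I_n}) :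
    #|[set f : {ffun 'I_n -> 'I_n} | is_parking f & dinjectiveb f D]%SET| = I #|D|.
  by rewrite /I -card_parking_inj_on mulnK.
have N0 : n.+1%:R != 0 :> R by rewrite pnatr_eq0.
have IE m : (m <= n)%N -> (I m)%:R = (n.+1 ^_ m)%:R * n.+1%:R ^+ (n - m) / n.+1%:R :> R.
  move=> mn; have [|D cD] := @exists_set_card 'I_n m; first by rewrite card_ord.
  by rewrite -cD -hI -natrX -natrM -card_parking_inj_on natrM mulfK.
rewrite (sum_parking (fun f => (1 + y) ^+ num_dicycles (frel f))).
rewrite (sum_num_dicycles_inj is_parking_perm y hI) card_ord.
have -> : #|{: parking n}|%:R = n.+1%:R ^+ n / n.+1%:R :> R.
  have := IE 0%N isT; rewrite ffactn0 mul1r subn0 => <-.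
  rewrite -(cards0 'I_n) -hI -!sum1_card (sum_parking (fun=> 1%N)); congr (_%:R).
  apply: eq_bigl => f; rewrite inE; apply/esym/andb_idr => _.
  by apply/dinjectiveP => x; rewrite inE.
rewrite mulr_suml; apply: eq_bigr => m _; have mn : (m <= n)%N by rewrite -ltnS.
have eN : n.+1%:R ^+ n = n.+1%:R ^+ m * n.+1%:R ^+ (n - m) :> R.
  by rewrite -exprD subnKC.
rewrite IE // eN -!mulrA; congr (_ * _).
have : n.+1%:R ^+ m != 0 :> R by rewrite expf_neq0.
have : n.+1%:R ^+ (n - m) != 0 :> R by rewrite expf_neq0.
move: N0 (_ ^+ _) (_ ^+ m) => /[swap] u /[swap] v; move: (n.+1%:R : R) => N N0 u0 v0; field.
by rewrite u0 v0 N0 pnatr_eq0 -lt0n fact_gt0.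
Qed.
End ParkingMean.

(** * Growth of the generating function *)

Section Asymptotics.
Local Open Scope ring_scope.
Variable R : realType.
Implicit Types (y x : R) (m n N : nat).

Lemma ln_le_sub1 x : 0 < x -> ln x <= x - 1.
Proof.
by move=> x0; rewrite lerBrDl -[leRHS](lnK x0) expR_ge1Dx.
Qed.

Lemma ln_ge_1subV x : 0 < x -> 1 - x^-1 <= ln x.
Proof.
move=> x0; have := @ln_le_sub1 x^-1; rewrite invr_gt0 lnV ?posrE // => /(_ x0).
by lra.
Qed.

(** The mean of [(1 + y) ^ c], where [c] is the number of cycles of a uniform
    permutation of [m] points. *)
Definition perm_pgf y m : R := \prod_(j < m) (1 + y / j.+1%:R).

Lemma perm_pgfS y m : perm_pgf y m.+1 = perm_pgf y m * (1 + y / m.+1%:R).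
Proof. by rewrite /perm_pgf big_ord_recr. Qed.

Lemma perm_pgf0 y : perm_pgf y 0 = 1.
Proof. by rewrite /perm_pgf big_ord0. Qed.

Lemma perm_pgf_factor_gt0 y m : -1 < y -> 0 < 1 + y / m.+1%:R.
Proof.
move=> y1; have m0 : (0 : R) < m.+1%:R by rewrite ltr0n.
rewrite -(ltr_pM2r m0) mul0r mulrDl divfK ?gt_eqF // mul1r.
have : (1 : R) <= m.+1%:R by rewrite ler1n.
by lra.
Qed.

Lemma perm_pgf_gt0 y m : -1 < y -> 0 < perm_pgf y m.
Proof. by move=> y1; apply: prodr_gt0 => j _; exact: perm_pgf_factor_gt0. Qed.

(** The right-hand side is [perm_pgf y m.+1 - perm_pgf y m]. *)
Lemma rising_fact y m :
  rising y m.+1 / m.+1`!%:R = perm_pgf y m * (y / m.+1%:R).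
Proof.
elim: m => [|m IH].
  by rewrite /rising big_ord1 perm_pgf0 addr0 mul1r.
rewrite /rising big_ord_recr /= -/(rising y m.+1) factS natrM.
rewrite [m.+2%:R * _]mulrC invfM mulrACA IH perm_pgfS.
have : m.+1%:R != 0 :> R by rewrite pnatr_eq0.
have : m.+2%:R != 0 :> R by rewrite pnatr_eq0.
by move: (m.+1%:R : R) (m.+2%:R : R) (perm_pgf y m) => u v a u0 v0; field; rewrite u0 v0.
Qed.

(** [perm_pgf y m] is [m ^ y] up to constants: the increments of the two logarithms
    differ by at most a constant times [1 / j - 1 / (j + 1)], which telescopes. *)
Lemma ln_perm_pgf_bound y m : -1 < y ->
  `|ln (perm_pgf y m) - y * ln m.+1%:R| <=
    (`|y| + y ^+ 2 * (1 + 2 / (1 + y))) * (1 - m.+1%:R^-1).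
Proof.
move=> y1; set K := `|y| + y ^+ 2 * _.
elim: m => [|m IH]; first by rewrite perm_pgf0 ln1 invr1 subrr !mulr0 subrr normr0.
have f0 := perm_pgf_factor_gt0 m y1; have a0 := perm_pgf_gt0 m y1.
rewrite perm_pgfS lnM ?posrE //.
have j0 : (0 : R) < m.+1%:R by rewrite ltr0n.
have j1 : (1 : R) <= m.+1%:R by rewrite ler1n.
have eJ : m.+2%:R = m.+1%:R + 1 :> R by rewrite -natr1.
rewrite eJ; move: f0 IH; move: (m.+1%:R : R) j0 j1 => j j0 j1 f0 IH.
have jn0 : j != 0 by rewrite gt_eqF.
have j10 : 0 < j + 1 by lra.
have jy0 : 0 < j + y by lra.
have -> : ln (j + 1) = ln j + ln (1 + j^-1).
  rewrite -lnM ?posrE ?addr_gt0 ?invr_gt0 //.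
  by congr ln; field.
have hu := ln_le_sub1 f0; have hl := ln_ge_1subV f0.
have g0 : 0 < 1 + j^-1 by rewrite addr_gt0 ?invr_gt0.
have gu := ln_le_sub1 g0; have gl := ln_ge_1subV g0.
pose d := (j * (j + 1))^-1.
have d0 : 0 < d by rewrite invr_gt0 mulr_gt0.
have ed : d = j^-1 - (j + 1)^-1 by rewrite /d; field; rewrite jn0 gt_eqF.
have gl' : j^-1 - d <= ln (1 + j^-1).
  by apply: le_trans gl; rewrite /d le_eqVlt; apply/orP; left; apply/eqP; field; rewrite jn0 gt_eqF.
have h1 : `|y * ln (1 + j^-1) - y / j| <= `|y| * d.
  rewrite -mulrBr normrM ler_wpM2l // ler_norml.
  by apply/andP; split; lra.
(* The constant comes from [j + 1 <= (1 + 2 / (1 + y)) * (j + y)] for [1 <= j]. *)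
have h2 : y / j - y ^+ 2 * (1 + 2 / (1 + y)) * d <= ln (1 + y / j).
  apply: le_trans hl.
  have -> : 1 - (1 + y / j)^-1 = y / j - y ^+ 2 * (j * (j + y))^-1.
    by field; rewrite jn0 gt_eqF // addrC gt_eqF.
  rewrite lerB // -mulrA ler_wpM2l ?sqr_ge0 // /d !invfM mulrCA ler_wpM2l ?invr_ge0 ?(ltW j0) //.
  have y10 : 0 < 1 + y by lra.
  have w2 : 2 / (1 + y) * (1 + y) = 2 by rewrite divfK // gt_eqF.
  have w0 : 0 < 2 / (1 + y) by rewrite divr_gt0.
  rewrite -[leLHS]mul1r ler_pdivrMr // mulrAC ler_pdivlMr //.
  by move: (2 / (1 + y)) w2 w0 => w w2 w0; nra.
have eK : K * (1 - (j + 1)^-1) =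
    K * (1 - j^-1) + `|y| * d + y ^+ 2 * (1 + 2 / (1 + y)) * d.
  by rewrite /K ed; move: (y ^+ 2 * _) `|y| j^-1 (j + 1)^-1 => ? ? ? ?; ring.
have hu' : ln (1 + y / j) <= y / j by lra.
have q0 : 0 <= y ^+ 2 * (1 + 2 / (1 + y)) * d.
  have y10 : 0 < 2 / (1 + y) by rewrite divr_gt0 //; lra.
  apply: mulr_ge0 (ltW d0); apply: mulr_ge0 (sqr_ge0 y) _.
  by rewrite addr_ge0 // ltW.
rewrite eK mulrDr; move: IH h1; rewrite !ler_norml.
by move=> /andP[? ?] /andP[? ?]; apply/andP; split; lra.
Qed.
End Asymptotics.

Section MeanBounds.
Local Open Scope ring_scope.
Variable R : realType.
Implicit Types (y x : R) (m n N : nat).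

(** The probability that [m] given points have distinct images under a uniform
    function into [N.+1] points. *)
Definition inj_prob N m : R := (N.+1 ^_ m)%:R / N.+1%:R ^+ m.

(** The probability that the image of one more point falls among [m] distinct ones. *)
Definition hazard N m : R := m%:R / N.+1%:R.

Lemma inj_prob0 N : inj_prob N 0 = 1.
Proof. by rewrite /inj_prob ffactn0 divr1. Qed.

Lemma inj_probS N m : (m <= N.+1)%N -> inj_prob N m.+1 = inj_prob N m * (1 - hazard N m).
Proof.
move=> mN; have N0 : N.+1%:R != 0 :> R by rewrite pnatr_eq0.
rewrite /inj_prob /hazard ffactnSr natrM natrB // exprS.
have : N.+1%:R ^+ m != 0 :> R by rewrite expf_neq0.
by move: (_ ^+ m) N0 (N.+1 ^_ m)%:R => u; move: (N.+1%:R : R) => v v0 w u0; field; rewrite u0 v0.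
Qed.

Lemma inj_prob_ge0 N m : 0 <= inj_prob N m.
Proof. by rewrite divr_ge0 // exprn_ge0. Qed.

Lemma hazard_ge0 N m : 0 <= hazard N m.
Proof. by rewrite divr_ge0. Qed.

Lemma hazard_le1 N m : (m <= N.+1)%N -> 0 <= hazard N m <= 1.
Proof.
move=> mN; rewrite hazard_ge0 /=.
by rewrite /hazard ler_pdivrMr ?ltr0n // mul1r ler_nat.
Qed.

Lemma inj_prob_le1 N m : (m <= N.+2)%N -> inj_prob N m <= 1.
Proof.
elim: m => [|m IH] mN; first by rewrite inj_prob0.
rewrite inj_probS //; have := IH (ltnW mN); have := inj_prob_ge0 N m.
by have /andP[] := @hazard_le1 N m mN; nra.
Qed.

(** For [B = N] this is the mean of [(1 + y) ^ K] over parking functions of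
    length [N]. *)
Definition partial_mean N y B : R :=
  1 + \sum_(m < B) inj_prob N m.+1 * (perm_pgf y m * (y / m.+1%:R)).

(** Summation by parts. For [-1 < y] all terms are now nonnegative:
    [inj_prob N m * hazard N m] is the probability that exactly [m] distinct images
    precede the first repetition. *)
Lemma partial_mean_parts N y B : (B <= N.+2)%N ->
  partial_mean N y B =
  \sum_(m < B) inj_prob N m * perm_pgf y m * hazard N m + inj_prob N B * perm_pgf y B.
Proof.
rewrite /partial_mean; elim: B => [|B IH] BN.
  by rewrite !big_ord0 inj_prob0 perm_pgf0; ring.
rewrite !big_ord_recr /= addrA IH 1?ltnW // inj_probS // perm_pgfS.
by ring.
Qed.

Lemma sum_inj_prob N B : (B <= N.+2)%N ->
  \sum_(m < B) inj_prob N m * hazard N m = 1 - inj_prob N B.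
Proof.
elim: B => [|B IH] BN; first by rewrite big_ord0 inj_prob0 subrr.
by rewrite big_ord_recr /= IH 1?ltnW // inj_probS //; ring.
Qed.

Lemma inj_prob_lower N m : (m <= N.+2)%N -> 1 - m%:R ^+ 2 / (2 * N.+1%:R) <= inj_prob N m.
Proof.
elim: m => [|m IH] mN; first by rewrite inj_prob0 expr0n /= mul0r subr0.
rewrite inj_probS //; have := IH (ltnW mN); have := @inj_prob_le1 N m (ltnW mN).
have := inj_prob_ge0 N m; have /andP[] := @hazard_le1 N m mN.
rewrite /hazard -[m.+1%:R]natr1 invfM; set u := (N.+1%:R)^-1 => h1 h2 h3 h4 h5.
have u0 : 0 <= u by rewrite invr_ge0.
have : inj_prob N m * (m%:R * u) <= m%:R * u by rewrite -[leRHS]mul1r ler_wpM2r.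
by move: h5; rewrite sqrrD1; nra.
Qed.

Lemma inj_prob_upper N m : (m <= N.+2)%N ->
  inj_prob N m * (1 + m%:R * (m%:R - 1) / (2 * N.+1%:R)) <= 1.
Proof.
elim: m => [|m IH] mN; first by rewrite inj_prob0 !mul0r addr0 mul1r.
rewrite inj_probS //; apply: le_trans (IH (ltnW mN)).
rewrite -mulrA ler_wpM2l ?inj_prob_ge0 //.
have /andP[r0 _] := @hazard_le1 N m mN.
have -> : m.+1%:R * (m.+1%:R - 1) / (2 * N.+1%:R) =
    m%:R * (m%:R - 1) / (2 * N.+1%:R) + hazard N m.
  by rewrite /hazard -[m.+1%:R]natr1 !invfM; move: (N.+1%:R)^-1 => u; field.
have c0 : 0 <= m%:R * (m%:R - 1) / (2 * N.+1%:R) :> R.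
  apply: divr_ge0; last by rewrite mulr_ge0.
  by case: (m) => [|k]; rewrite ?mul0r // mulr_ge0 // subr_ge0 ler1n.
by move: (_ / _) (hazard N m) c0 r0 => c r; nra.
Qed.

Lemma partial_mean_ge N y A : 0 <= y -> (A <= N)%N ->
  inj_prob N A * perm_pgf y A <= partial_mean N y N.
Proof.
move=> y0 An; have y1 : -1 < y by lra.
apply: (@le_trans _ _ (partial_mean N y A)).
  rewrite partial_mean_parts; last by rewrite (leq_trans An) // ltnW.
  rewrite lerDr sumr_ge0 // => m _.
  by rewrite !mulr_ge0 ?inj_prob_ge0 ?hazard_ge0 ?invr_ge0 // ltW // perm_pgf_gt0.
rewrite lerD2l -(subnKC An) big_split_ord /= lerDl sumr_ge0 // => m _.
by rewrite !mulr_ge0 ?inj_prob_ge0 ?hazard_ge0 ?invr_ge0 // ltW // perm_pgf_gt0.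
Qed.

(** The terms of the defining sum and of its summation by parts are in the ratio
    [y (N + 1) / (m (m + 1))], at most [1/2] from [B] on. So the terms from [B] on
    account for at most half of the mean, and those before [B] telescope to
    [perm_pgf y B]. *)
Lemma partial_mean_le N y B : 0 <= y ->
  2 * y * N.+1%:R <= B%:R ^+ 2 -> partial_mean N y N <= 2 * perm_pgf y B.
Proof.
move=> y0 hB; have y1 : -1 < y by lra.
have a0 m : 0 <= perm_pgf y m by rewrite ltW // perm_pgf_gt0.
have ayE m : perm_pgf y m * (y / m.+1%:R) = perm_pgf y m.+1 - perm_pgf y m.
  by rewrite perm_pgfS; ring.
have amono m m' : (m <= m')%N -> perm_pgf y m <= perm_pgf y m'.
  move: m m'; apply/(nondecreasing_seqP (perm_pgf y)) => k.
  by rewrite -subr_ge0 -ayE mulr_ge0 // divr_ge0.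
have head k : 1 + \sum_(m < k) (if (m < B)%N then perm_pgf y m * (y / m.+1%:R) else 0)
    <= perm_pgf y B.
  suff -> : 1 + \sum_(m < k) (if (m < B)%N then perm_pgf y m * (y / m.+1%:R) else 0) =
      perm_pgf y (minn k B).
    by rewrite amono // geq_minr.
  elim: k => [|k IH]; first by rewrite big_ord0 min0n perm_pgf0 addr0.
  rewrite big_ord_recr /= addrA IH; case: ltnP => kB.
    by rewrite (minn_idPl kB) ayE addrC subrK.
  by rewrite addr0 (minn_idPr (leqW kB)).
have N0R : (0 : R) < N.+1%:R by rewrite ltr0n.
have tailE : \sum_(m < N) inj_prob N m * perm_pgf y m * hazard N m <= partial_mean N y N.
  rewrite partial_mean_parts; last by rewrite ltnW.
  by rewrite lerDl mulr_ge0 ?inj_prob_ge0.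
have key : partial_mean N y N <= perm_pgf y B + 2^-1 *
    \sum_(m < N) inj_prob N m * perm_pgf y m * hazard N m.
  apply: le_trans (lerD (head N) (lexx _)); rewrite -addrA lerD2l mulr_sumr -big_split /=.
  apply: ler_sum => m _; have mN : (m <= N.+1)%N by rewrite ltnW // ltnW // ltnS.
  have rm := @hazard_le1 N m mN; have sS : inj_prob N m.+1 <= inj_prob N m.
    rewrite inj_probS // -[leRHS]mulr1 ler_wpM2l ?inj_prob_ge0 //.
    by case/andP: rm; lra.
  have z0 : 0 <= perm_pgf y m * (y / m.+1%:R) by rewrite mulr_ge0 // divr_ge0.
  case: ltnP => mB.
    have z1 : 0 <= 2^-1 * (inj_prob N m * perm_pgf y m * hazard N m).
      by rewrite !mulr_ge0 ?inj_prob_ge0 ?hazard_ge0 ?invr_ge0.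
    have := @inj_prob_le1 N m.+1 mN => q1.
    apply: le_trans (lerD (lexx _) z1); rewrite addr0 -[leRHS]mul1r ler_wpM2r //.
  rewrite add0r; apply: (@le_trans _ _ (inj_prob N m * (perm_pgf y m * (y / m.+1%:R)))).
    by rewrite ler_wpM2r.
  have -> : 2^-1 * (inj_prob N m * perm_pgf y m * hazard N m) =
      inj_prob N m * (perm_pgf y m * (2^-1 * hazard N m)) by ring.
  rewrite !ler_wpM2l ?inj_prob_ge0 // ler_pdivrMr ?ltr0n // /hazard mulrA mulrAC.
  rewrite ler_pdivlMr //; have : (B%:R : R) <= m%:R by rewrite ler_nat.
  have : (0 : R) <= B%:R by []; rewrite -[m.+1%:R]natr1.
  by move: hB; rewrite expr2; nra.
by lra.
Qed.

Lemma perm_pgf_anti y m m' : -1 < y -> y <= 0 -> (m <= m')%N ->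
  perm_pgf y m' <= perm_pgf y m.
Proof.
move=> y1 y0; move: m m'; apply/(nonincreasing_seqP (perm_pgf y)) => k.
rewrite perm_pgfS -[leRHS]mulr1 ler_wpM2l ?(ltW (perm_pgf_gt0 _ y1)) //.
by rewrite gerDl mulr_le0_ge0 // invr_ge0.
Qed.

Lemma partial_mean_ge_neg N y A : -1 < y -> y <= 0 -> (A <= N)%N ->
  perm_pgf y A * (1 - inj_prob N A) <= partial_mean N y N.
Proof.
move=> y1 y0 An; have a0 m : 0 <= perm_pgf y m by rewrite ltW // perm_pgf_gt0.
rewrite partial_mean_parts; last by rewrite ltnW.
rewrite -sum_inj_prob; last by rewrite (leq_trans An) // ltnW.
apply: (@le_trans _ _ (\sum_(m < A) inj_prob N m * perm_pgf y m * hazard N m)).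
  rewrite mulr_sumr; apply: ler_sum => m _.
  rewrite mulrA ler_wpM2r ?hazard_ge0 // mulrC ler_wpM2l ?inj_prob_ge0 //.
  by rewrite perm_pgf_anti // ltnW.
rewrite -(subnKC An) big_split_ord /= -addrA lerDl.
by rewrite addr_ge0 ?sumr_ge0 // => [m _|]; rewrite !mulr_ge0 ?inj_prob_ge0 ?hazard_ge0 ?invr_ge0.
Qed.

Lemma partial_mean_le_neg N y B : -1 < y -> y <= 0 -> (B <= N)%N ->
  partial_mean N y N <= \sum_(m < B) perm_pgf y m * hazard N m + perm_pgf y B.
Proof.
move=> y1 y0 Bn; have a0 m : 0 <= perm_pgf y m by rewrite ltW // perm_pgf_gt0.
apply: (@le_trans _ _ (partial_mean N y B)).
  rewrite lerD2l -(subnKC Bn) big_split_ord /= gerDl -oppr_ge0 -sumrN sumr_ge0 // => m _.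
  rewrite -mulrN mulr_ge0 ?inj_prob_ge0 // -mulrN mulr_ge0 // -mulNr divr_ge0 // oppr_ge0 //.
have BN : (B <= N.+2)%N by rewrite (leq_trans Bn) // ltnW.
rewrite partial_mean_parts // lerD //; last by rewrite -[leRHS]mul1r ler_wpM2r // inj_prob_le1.
apply: ler_sum => m _; rewrite ler_wpM2r ?hazard_ge0 // -[leRHS]mul1r ler_wpM2r // inj_prob_le1 //.
by rewrite (leq_trans _ BN) // ltnW.
Qed.
End MeanBounds.

Section Growth.
Local Open Scope ring_scope.
Variable R : realType.

Lemma nat_sqrt (N : nat) : exists r : nat, (r ^ 2 <= N < r.+1 ^ 2)%N.
Proof.
elim: N => [|N [r /andP[h1 h2]]]; first by exists 0%N.
have [h|h] := leqP (r.+1 ^ 2) N.+1; last by exists r; rewrite h leqW.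
by exists r.+1; rewrite h (leq_ltn_trans h2) // ltn_exp2r.
Qed.

(** The number of distinct images before the first repetition is of the order of
    [sqrt n], so the mean is [sqrt n ^ y] up to constants. For either sign of [y]
    the lower and the upper bound cut the sum at a multiple of [sqrt n]. *)
Lemma ln_partial_mean (y : R) : -1 < y -> exists C : R, forall n, (9 <= n)%N ->
  0 < partial_mean n y n /\ `|ln (partial_mean n y n) - y / 2 * ln n.+1%:R| <= C.
Proof.
move=> y1; pose K : R := `|y| + y ^+ 2 * (1 + 2 / (1 + y)).
have K0 : 0 <= K.
  rewrite addr_ge0 ?normr_ge0 // mulr_ge0 ?sqr_ge0 // addr_ge0 // divr_ge0 //; lra.
have aK m : `|ln (perm_pgf y m) - y * ln m.+1%:R| <= K.
  apply: le_trans (ln_perm_pgf_bound m y1) _; rewrite -/K.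
  by rewrite mulrBr mulr1 lerBlDr lerDl mulr_ge0 // invr_ge0.
have a0 m : 0 < perm_pgf y m by exact: perm_pgf_gt0.
have aU m : ln (perm_pgf y m) <= K + y * ln m.+1%:R.
  by have := aK m; rewrite ler_norml => /andP[_]; rewrite lerBlDr.
have aL m : y * ln m.+1%:R - K <= ln (perm_pgf y m).
  by have := aK m; rewrite ler_norml => /andP[+ _]; lra.
pose k := (Num.truncn (2 * y)).+1.
have ky : 2 * y <= k%:R ^+ 2.
  apply: (@le_trans _ _ k%:R); first exact/ltW/truncnS_gt.
  by rewrite -natrX ler_nat leq_pmull.
have ln_nat m m' : (0 < m)%N -> (m <= m')%N -> ln (m%:R : R) <= ln m'%:R.
  by move=> m0 mm'; rewrite ler_ln ?posrE ?ltr0n ?ler_nat // (leq_trans m0).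
have ln_nat0 m : (0 < m)%N -> 0 <= ln (m%:R : R).
  by move=> m0; rewrite -(ln1 R); exact: (ln_nat 1%N).
exists (K + ln 2 + `|y| * (ln k.+1%:R + ln 2 + ln 5)) => n n9.
have [r /andP[r1 r2]] := nat_sqrt n.+1.
have r3 : (3 <= r)%N by nia.
have r0 : (0 < r)%N by exact: leq_trans r3.
(* Both cuts at which a lower bound is read off are within range as [9 <= n]. *)
have [rn r2n] : (r <= n)%N /\ (2 * r.+1 <= n)%N by split; nia.
pose L : R := ln n.+1%:R; pose l0 : R := ln r%:R; pose l1 : R := ln r.+1%:R.
have lM m m' : (0 < m)%N -> (0 < m')%N -> ln ((m * m')%:R : R) = ln m%:R + ln m'%:R.
  by move=> m0 m'0; rewrite natrM lnM ?posrE ?ltr0n.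
have L0 : 2 * l0 <= L.
  by rewrite mulr_natl mulr2n -lM ?ln_nat ?mulnn //; lia.
have L1 : L <= 2 * l1.
  by rewrite mulr_natl mulr2n -lM ?ln_nat ?mulnn //; lia.
have l10 : l1 <= l0 + ln 2.
  by rewrite -lM ?ln_nat //; lia.
have nR : (0 : R) < n.+1%:R by rewrite ltr0n.
have c2 : 0 <= ln (2 : R) by exact: ln_nat0.
have c5 : 0 <= ln (5 : R) by exact: ln_nat0.
have ck : 0 <= ln (k.+1%:R : R) by exact: ln_nat0.
have half0 : (0 : R) < 2^-1 by rewrite invr_gt0.
have [y0|y0] := leP 0 y.
  (* The cuts are at [r] and at [k * r.+1], where [2 * y <= k ^ 2]. *)
  have lb : 2^-1 * perm_pgf y r <= partial_mean n y n.
    apply: le_trans (partial_mean_ge y0 rn); rewrite ler_wpM2r ?(ltW (a0 _)) //.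
    apply: le_trans (@inj_prob_lower _ _ _ (leqW (leqW rn))).
    have : r%:R ^+ 2 / (2 * n.+1%:R) <= 2^-1 :> R.
      by rewrite ler_pdivrMr ?mulr_gt0 // mulKf // -natrX ler_nat.
    by move: (_ / _) => c; lra.
  have lb0 : 0 < 2^-1 * perm_pgf y r by rewrite mulr_gt0.
  have E0 := lt_le_trans lb0 lb; split=> //.
  have ub : partial_mean n y n <= 2 * perm_pgf y (k * r.+1).
    apply: partial_mean_le => //; rewrite natrM exprMn ler_pM ?mulr_ge0 //.
    by rewrite -natrX ler_nat ltnW.
  have e1 : ln (partial_mean n y n) <= ln 2 + (K + y * (ln k.+1%:R + l1)).
    apply: (@le_trans _ _ (ln 2 + ln (perm_pgf y (k * r.+1)))).
      by rewrite -lnM ?posrE // ler_ln // posrE mulr_gt0.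
    rewrite lerD2l; apply: le_trans (aU _) _; rewrite lerD2l ler_wpM2l //.
    by rewrite -lM // ln_nat // mulSn -add1n leq_add2r.
  have e2 : y * l1 - K - ln 2 <= ln (partial_mean n y n).
    apply: (@le_trans _ _ (ln (2^-1 * perm_pgf y r))); last by rewrite ler_ln ?posrE.
    by rewrite lnM ?posrE // lnV ?posrE //; have := aL r; rewrite -/l1; lra.
  rewrite (ger0_norm y0) ler_norml -/L.
  have h1 := ler_wpM2l y0 L1; have h2 := ler_wpM2l y0 l10.
  have h3 := ler_wpM2l y0 L0; have h4 := mulr_ge0 y0 ck.
  have h5 := mulr_ge0 y0 c2; have h6 := mulr_ge0 y0 c5.
  by apply/andP; split; lra.
(* The cuts are at [2 * r.+1] and at [r]. *)
have y0' := ltW y0.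
have lb : 2^-1 * perm_pgf y (2 * r.+1) <= partial_mean n y n.
  apply: le_trans (partial_mean_ge_neg y1 y0' r2n); rewrite mulrC ler_wpM2l ?(ltW (a0 _)) //.
  have := @inj_prob_upper R n _ (leqW (leqW r2n)); have := @inj_prob_ge0 R n (2 * r.+1).
  set q := inj_prob _ _; set c := _ / _ => q0.
  suff c1 : 1 <= c by have := ler_wpM2l q0 c1; rewrite mulr1 mulrDr mulr1; lra.
  have -> : c = (2 * r.+1 * (2 * r).+1)%:R / (2 * n.+1)%:R.
    by rewrite /c !natrM; congr (_ * _ / _); rewrite -[(2 * r).+1%:R]natr1 natrM -natr1; ring.
  rewrite ler_pdivlMr ?ltr0n // mul1r ler_nat -mulnA leq_mul2l /=.
  by apply: leq_trans (ltnW r2) _; rewrite -mulnn leq_mul2l ltnS leq_pmull.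
have lb0 : 0 < 2^-1 * perm_pgf y (2 * r.+1) by rewrite mulr_gt0.
have E0 := lt_le_trans lb0 lb; split=> //.
have e2 : y * (ln 5 + l0) - K - ln 2 <= ln (partial_mean n y n).
  apply: (@le_trans _ _ (ln (2^-1 * perm_pgf y (2 * r.+1)))); last by rewrite ler_ln ?posrE.
  rewrite lnM ?posrE // lnV ?posrE //; have := aL (2 * r.+1)%N.
  have r5 : ((2 * r.+1).+1 <= 5 * r)%N by clear -r3; lia.
  have : ln ((2 * r.+1).+1%:R : R) <= ln 5 + l0.
    by rewrite -(lM 5%N) ?ln_nat //; apply: leq_trans r3.
  by move=> /(ler_wnM2l y0'); lra.
have expa m : perm_pgf y m <= expR (K + y * ln m.+1%:R).
  by rewrite -[leLHS]lnK ?posrE // ler_expR.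
have rE : expR l0 = r%:R by rewrite lnK // posrE ltr0n.
have ub : partial_mean n y n <= 2 * expR (K + y * l0).
  apply: le_trans (partial_mean_le_neg y1 y0' rn) _.
  rewrite [2 * _]mulr_natl mulr2n; apply: lerD; last first.
    apply: le_trans (expa r) _; rewrite ler_expR lerD2l -/l1.
    by rewrite ler_wnM2l // ln_nat.
  apply: (@le_trans _ _ (\sum_(m < r) expR (K + (y + 1) * l0) / n.+1%:R)).
    apply: ler_sum => m _; rewrite /hazard mulrA ler_wpM2r ?invr_ge0 //.
    apply: (@le_trans _ _ (expR (K + y * ln m.+1%:R) * m.+1%:R)).
      by rewrite ler_pM ?(ltW (a0 _)) ?ler_nat.
    rewrite -[X in _ * X]lnK ?posrE ?ltr0n // -expRD ler_expR.
    have : ln (m.+1%:R : R) <= l0 by rewrite ln_nat.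
    by nra.
  rewrite sumr_const card_ord -[_ *+ r]mulr_natr mulrAC ler_pdivrMr // -rE -expRD.
  have -> : K + (y + 1) * l0 + l0 = (K + y * l0) + (l0 + l0) by ring.
  rewrite expRD ler_wpM2l ?expR_ge0 // expRD rE -natrM ler_nat.
  by move: r1; rewrite -mulnn.
have e1 : ln (partial_mean n y n) <= ln 2 + (K + y * l0).
  rewrite -[X in _ + X]expRK -lnM ?posrE ?expR_gt0 // ler_ln ?posrE //.
  by rewrite mulr_gt0 ?expR_gt0.
rewrite (ltr0_norm y0) ler_norml -/L.
have z0 : 0 <= - y by rewrite oppr_ge0.
have h1 := ler_wpM2l z0 L1; have h2 := ler_wpM2l z0 l10.
have h3 := ler_wpM2l z0 L0; have h4 := mulr_ge0 z0 ck.
have h5 := mulr_ge0 z0 c2; have h6 := mulr_ge0 z0 c5.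
by apply/andP; split; lra.
Qed.

Definition cycle_mgf n (t : R) : R :=
  (\sum_(p : parking n) expR (t * (parking_cycles p)%:R)) / #|{: parking n}|%:R.

Lemma cycle_mgfE n t : cycle_mgf n t = partial_mean n (expR t - 1) n.
Proof.
rewrite /cycle_mgf (eq_bigr (fun p => (1 + (expR t - 1)) ^+ parking_cycles p)); last first.
  by move=> p _; rewrite addrC subrK -expRM_natr.
rewrite mean_expr_parking_cycles /partial_mean big_ord_recl /=; congr (_ + _).
  by rewrite /rising big_ord0 fact0 ffactn0 expr0 !divr1 mulr1.
by apply: eq_bigr => m _; rewrite /bump leq0n add1n rising_fact mulrC.
Qed.

(** The number of cycles is close, on the scale of exponential moments, to a
    Poisson variable of parameter [ln n / 2]. *)
Lemma ln_cycle_mgf t : exists C : R, forall n, (9 <= n)%N ->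
  0 < cycle_mgf n t /\ `|ln (cycle_mgf n t) - (expR t - 1) / 2 * ln n%:R| <= C.
Proof.
have y1 : -1 < expR t - 1 by rewrite ltrBrDl subrr expR_gt0.
have [C hC] := ln_partial_mean y1.
exists (C + `|(expR t - 1) / 2| * ln 2) => n n9; rewrite cycle_mgfE.
have [E0 hE] := hC n n9; split=> //.
have n0 : (0 < n)%N by exact: leq_trans n9.
have h1 : ln (n%:R : R) <= ln n.+1%:R by rewrite ler_ln ?posrE ?ltr0n ?ler_nat.
have h2 : ln (n.+1%:R : R) <= ln n%:R + ln 2.
  rewrite -lnM ?posrE ?ltr0n // -natrM ler_ln ?posrE ?ltr0n ?muln_gt0 ?n0 //.
  by rewrite ler_nat; lia.
set c := _ / 2 in hE *.
have -> : ln (partial_mean n (expR t - 1) n) - c * ln n%:R =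
  (ln (partial_mean n (expR t - 1) n) - c * ln n.+1%:R) + c * (ln n.+1%:R - ln n%:R) by ring.
apply: le_trans (ler_normD _ _) (lerD hE _).
by rewrite normrM ler_wpM2l // ger0_norm; lra.
Qed.
End Growth.

Local Open Scope classical_set_scope.
Local Open Scope ring_scope.

(** * The rate function as a Legendre transform *)

Section Rate.
Local Open Scope ring_scope.
Variable R : realType.
Implicit Types (t x y : R).

(** The limit of [ln (cycle_mgf n t) / ln n]. *)
Definition log_mgf t : R := (expR t - 1) / 2.

Lemma log_mgf_ln x : 0 < x -> log_mgf (ln (2 * x)) = x - 2^-1.
Proof. by move=> x0; rewrite /log_mgf lnK ?posrE ?mulr_gt0 //; field. Qed.

Definition rate x : R := x * ln (2 * x) - x + 2^-1.

Lemma rateE x : 0 < x -> rate x = x * ln (2 * x) - log_mgf (ln (2 * x)).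
Proof. by move=> x0; rewrite log_mgf_ln // /rate; ring. Qed.

(** [rate] is the Legendre transform of [log_mgf], the supremum being attained only
    at [t = ln (2 * x)]; this is [1 + z < expR z] for [z = t - ln (2 * x)]. *)
Lemma young_lt x t : 0 < x -> expR t != 2 * x -> x * t - log_mgf t < rate x.
Proof.
move=> x0 tx; have x20 : 0 < 2 * x by rewrite mulr_gt0.
pose z := t - ln (2 * x).
have z0 : z != 0.
  by apply: contraNneq tx => /eqP; rewrite subr_eq0 => /eqP ->; rewrite lnK // posrE.
have h : 1 + z < expR z by rewrite expR_gt1Dx.
have e : expR t = 2 * x * expR z.
  by rewrite /z expRD expRN lnK ?posrE // mulrCA divff ?mulr1 // gt_eqF.
have tE : t = z + ln (2 * x) by rewrite /z subrK.
rewrite /rate /log_mgf e {1}tE; have := ltr_pM2l x0 (1 + z) (expR z).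
by rewrite h => /idP; lra.
Qed.

Lemma young x t : 0 <= x -> x * t - log_mgf t <= rate x.
Proof.
rewrite le_eqVlt => /orP[/eqP <-|x0].
  by rewrite /rate /log_mgf !mul0r; have := expR_gt0 t; lra.
have [e|/(young_lt x0)/ltW//] := eqVneq (expR t) (2 * x).
by rewrite rateE // -e expRK.
Qed.

Lemma cycle_rateE x : 0 <= x -> cycle_rate x = (rate x)%:E.
Proof. by rewrite /cycle_rate => ->. Qed.

Lemma cycle_rate_ge t x : ((x * t - log_mgf t)%:E <= cycle_rate x)%E.
Proof.
by rewrite /cycle_rate; case: ifP => [x0|_]; rewrite ?leey // lee_fin; exact: young.
Qed.

Lemma cycle_rate_ge0 x : (0 <= cycle_rate x)%E.
Proof.
have := cycle_rate_ge 0 x.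
by rewrite /log_mgf expR0 mulr0 subrr mul0r subrr.
Qed.

(** For [x <= 1/2], the mean of the limit, nonpositive slopes suffice in the
    Legendre transform, also where the rate is infinite. *)
Lemma cycle_rate_gt_left x a : x <= 2^-1 -> (a%:E < cycle_rate x)%E ->
  exists2 t, t <= 0 & a < x * t - log_mgf t.
Proof.
move=> x2; have [x0|x0|->] := ltgtP x 0.
- move=> _; exists ((`|a| + 1) / x).
    by rewrite mulr_ge0_le0 ?invr_le0 ?(ltW x0) // addr_ge0.
  rewrite mulrCA divff ?lt_eqF // mulr1.
  have : expR ((`|a| + 1) / x) <= 1.
    by rewrite -expR0 ler_expR mulr_ge0_le0 ?invr_le0 ?(ltW x0) // addr_ge0.
  by rewrite /log_mgf; have := ler_norm a; lra.
- rewrite cycle_rateE ?ltW // lte_fin rateE // => h; exists (ln (2 * x)) => //.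
  by apply: ln_le0; lra.
- rewrite cycle_rateE // lte_fin /rate !mul0r subr0 add0r => h.
  pose u : R := Num.min 1 ((1 - 2 * a) / 2).
  have u0 : 0 < u by rewrite lt_min ltr01 /= divr_gt0 //; lra.
  exists (ln u); first by apply: ln_le0; rewrite ge_min lexx.
  rewrite mul0r sub0r /log_mgf lnK ?posrE //.
  have : u <= (1 - 2 * a) / 2 by rewrite ge_min lexx orbT.
  by lra.
Qed.

Lemma cycle_rate_gt_right x a : 2^-1 <= x -> (a%:E < cycle_rate x)%E ->
  exists2 t, 0 <= t & a < x * t - log_mgf t.
Proof.
move=> x2; have x0 : 0 < x by lra.
rewrite cycle_rateE ?ltW // lte_fin rateE // => h; exists (ln (2 * x)) => //.
by apply: ln_ge0; lra.
Qed.

(** The rate is a supremum of affine functions. *)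
Lemma lower_semicontinuous_cycle_rate : lower_semicontinuous (@cycle_rate R).
Proof.
move=> x a ax; have [t at_] : exists t, a < x * t - log_mgf t.
  have [x2|x2] := leP x 2^-1.
    by have [t _ h] := cycle_rate_gt_left x2 ax; exists t.
  by have [t _ h] := cycle_rate_gt_right (ltW x2) ax; exists t.
exists [set y | a < y * t - log_mgf t].
  have ct : (fun y => y * t - log_mgf t) @ x --> x * t - log_mgf t.
    by apply: cvgB; [apply: cvgMl|exact: cvg_cst].
  exact: (cvgr_gt _ ct).
by move=> y /= h; apply: lt_le_trans (cycle_rate_ge t y); rewrite lte_fin.
Qed.

(** This lets points slightly to the right of 0 replace 0 in the lower bound. *)
Lemma cycle_rate_0_max x : 0 <= x -> x <= 2^-1 -> (cycle_rate x <= cycle_rate 0)%E.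
Proof.
move=> x0 x2; rewrite !cycle_rateE // lee_fin /rate !mul0r.
have : ln (2 * x) <= 0 by apply: ln_le0; lra.
by move=> /(ler_wpM2l x0); lra.
Qed.

End Rate.

(** * Exponential tilting *)

Section Tilting.
Local Open Scope ring_scope.
Variable R : realType.
Implicit Types (t x y b c : R) (n : nat).

Local Notation K p := ((parking_cycles p)%:R : R).

Definition mean n (phi : parking n -> R) : R :=
  (\sum_(p : parking n) phi p) / #|{: parking n}|%:R.

Lemma mean_le n (phi psi : parking n -> R) :
  (forall p, phi p <= psi p) -> mean phi <= mean psi.
Proof. by move=> h; rewrite ler_wpM2r ?invr_ge0 // ler_sum. Qed.

Lemma meanZ n (c : R) (phi : parking n -> R) :
  mean (fun p => c * phi p) = c * mean phi.
Proof. by rewrite /mean -mulr_sumr mulrA. Qed.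

Lemma meanD n (phi psi : parking n -> R) :
  mean (fun p => phi p + psi p) = mean phi + mean psi.
Proof. by rewrite /mean big_split mulrDl. Qed.

Definition prob n (b : pred (parking n)) : R := mean (fun p => (b p)%:R).

(** Not normalised: the total mass is [cycle_mgf n t]. *)
Definition tilted_prob n t (b : pred (parking n)) : R :=
  mean (fun p => expR (t * K p) * (b p)%:R).

Lemma tilted_prob0 n (b : pred (parking n)) : tilted_prob 0 b = prob b.
Proof.
rewrite /tilted_prob /prob /mean; congr (_ / _); apply: eq_bigr => p _.
by rewrite mul0r expR0 mul1r.
Qed.

(** Chernoff's bound, for the law tilted by [t]. *)
Lemma tilted_prob_le n t t' x (b : pred (parking n)) :
  (forall p, b p -> (t - t') * K p <= (t - t') * x) ->
  tilted_prob t b <= expR ((t - t') * x) * cycle_mgf n t'.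
Proof.
move=> hb; rewrite -meanZ; apply: mean_le => p.
case: (boolP (b p)) => [bp|_]; last by rewrite mulr0 mulr_ge0 ?expR_ge0.
rewrite mulr1 -expRD ler_expR.
by have := hb p bp; lra.
Qed.

Definition speed n : R := ln n%:R.

Lemma parking_cyclesE n (p : parking n) : 0 < speed n ->
  K p = cycles_over_log R p * speed n.
Proof. by move=> L0; rewrite divfK // gt_eqF. Qed.

Lemma cvg_speed : speed n @[n --> \oo] --> +oo.
Proof.
apply/cvgryPge => A; near=> n.
rewrite -[A]expRK /speed ler_ln ?posrE ?expR_gt0 //.
  by near: n; exact: nbhs_infty_ger.
apply: lt_le_trans (expR_gt0 A) _.
by near: n; exact: nbhs_infty_ger.
Unshelve. all: by end_near. Qed.

Lemma near_speed (A : R) : \forall n \near \oo, A <= speed n.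
Proof. by move/cvgryPge: cvg_speed; apply. Qed.

Lemma near_cycle_mgf_le t b c : log_mgf t < b -> 0 < c ->
  \forall n \near \oo, cycle_mgf n t <= c * expR (b * speed n).
Proof.
move=> tb c0; have [C hC] := @ln_cycle_mgf R t; near=> n.
have n9 : (9 <= n)%N by near: n; exact: nbhs_infty_ge.
have [M0 hM] := hC n n9.
rewrite -[leLHS]lnK ?posrE // -[c]lnK ?posrE // -expRD ler_expR.
move: hM; rewrite ler_norml => /andP[_]; rewrite -/(log_mgf t) -/(speed n) => hM.
have : (C - ln c) / (b - log_mgf t) <= speed n by near: n; exact: near_speed.
by rewrite ler_pdivrMr ?subr_gt0 //; lra.
Unshelve. all: by end_near. Qed.

Lemma near_cycle_mgf_ge t b c : b < log_mgf t -> 0 < c ->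
  \forall n \near \oo, c * expR (b * speed n) <= cycle_mgf n t.
Proof.
move=> tb c0; have [C hC] := @ln_cycle_mgf R t; near=> n.
have n9 : (9 <= n)%N by near: n; exact: nbhs_infty_ge.
have [M0 hM] := hC n n9.
rewrite -[leRHS]lnK ?posrE // -[c]lnK ?posrE // -expRD ler_expR.
move: hM; rewrite ler_norml => /andP[+ _]; rewrite -/(log_mgf t) -/(speed n) => hM.
have : (C + ln c) / (log_mgf t - b) <= speed n by near: n; exact: near_speed.
by rewrite ler_pdivrMr ?subr_gt0 //; lra.
Unshelve. all: by end_near. Qed.

Lemma near_tilted_prob_le t t' x b c (B : set R) :
  (forall y, B y -> (t - t') * y <= (t - t') * x) ->
  (t - t') * x + log_mgf t' < b -> 0 < c ->
  \forall n \near \oo,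
    tilted_prob t (fun p : parking n => `[< B (cycles_over_log R p) >]) <=
    c * expR (b * speed n).
Proof.
move=> hB hb c0.
have hb' : log_mgf t' < b - (t - t') * x by lra.
near=> n.
have L0 : 0 < speed n by apply: lt_le_trans ltr01 _; near: n; exact: near_speed.
apply: le_trans (@tilted_prob_le _ t t' (x * speed n) _ _) _.
  move=> p /asboolP /hB h; rewrite (parking_cyclesE p L0) mulrA [leRHS]mulrA.
  exact: ler_wpM2r (ltW L0) _ _ h.
have h : cycle_mgf n t' <= c * expR ((b - (t - t') * x) * speed n).
  by near: n; exact: near_cycle_mgf_le hb' c0.
apply: le_trans (ler_wpM2l (expR_ge0 _) h) _.
by rewrite mulrCA -expRD mulrA -mulrDl addrC subrK.
Unshelve. all: by end_near. Qed.

(** Under the tilt by [t = ln (2 * x)] the mass outside a neighbourhood of [x] is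
    exponentially smaller than the total mass, by strict inequality in Young's
    inequality. The mass near [x], of order [n ^ log_mgf t], is then tilted back. *)
Lemma near_prob_ge x b (B : set R) : 0 < x -> nbhs x B -> b < - rate x ->
  \forall n \near \oo,
    expR (b * speed n) <=
    prob (fun p : parking n => `[< B (cycles_over_log R p) >]).
Proof.
move=> x0 /nbhs_ballP[e /= e0 eB] bx.
pose t := ln (2 * x); pose g : R := (- rate x - b) / 2.
have g0 : 0 < g by rewrite /g; lra.
(* Within a distance [h] of [x] tilting back costs at most a factor
   [expR (g * speed n)] more than at [x] itself. *)
have [h [h0 he hx hg]] : exists h : R, [/\ 0 < h, h < e, h < x & `|t| * h <= g].
  pose h := Num.min (Num.min (e / 2) (x / 2)) (g / (`|t| + 1)).
  have t1 : 0 < `|t| + 1 by rewrite ltr_wpDl.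
  have h0 : 0 < h.
    by rewrite /h !lt_min (divr_gt0 e0) ?(divr_gt0 x0) ?(divr_gt0 g0).
  exists h; split.
  - exact: h0.
  - by apply: (@le_lt_trans _ _ (e / 2)); [rewrite /h !ge_min lexx|lra].
  - by apply: (@le_lt_trans _ _ (x / 2)); [rewrite /h !ge_min lexx orbT|lra].
  - have : h <= g / (`|t| + 1) by rewrite /h ge_min lexx orbT.
    rewrite ler_pdivlMr //; by lra.
have rate_lt (z : R) : 0 < z -> z != x -> (t - ln (2 * z)) * z + log_mgf (ln (2 * z)) < log_mgf t.
  move=> z0 zx; have := @young_lt R z t z0; rewrite rateE // lnK ?posrE ?mulr_gt0 //.
  rewrite (inj_eq (mulfI _)) ?pnatr_eq0 // eq_sym => /(_ zx).
  by lra.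
have r1 := rate_lt (x + h); have r2 := rate_lt (x - h).
have {}r1 : (t - ln (2 * (x + h))) * (x + h) + log_mgf (ln (2 * (x + h))) < log_mgf t.
  by apply: r1; [lra|rewrite -subr_eq0 addrC addKr gt_eqF].
have {}r2 : (t - ln (2 * (x - h))) * (x - h) + log_mgf (ln (2 * (x - h))) < log_mgf t.
  by apply: r2; [lra|rewrite -subr_eq0 addrC addKr oppr_eq0 gt_eqF].
pose a1 := (t - ln (2 * (x + h))) * (x + h) + log_mgf (ln (2 * (x + h))).
pose a2 := (t - ln (2 * (x - h))) * (x - h) + log_mgf (ln (2 * (x - h))).
(* [d] separates the exponents of both tails from that of the total mass. *)
have [d [d1 d2 d3 d4]] : exists d : R, [/\ a1 < d, a2 < d, d < log_mgf t & log_mgf t - g <= d].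
  pose m := Num.max (Num.max a1 a2) (log_mgf t - g).
  have mt : m < log_mgf t by rewrite /m !gt_max r1 r2 /=; lra.
  have m1 : a1 <= m by rewrite /m !le_max lexx.
  have m2 : a2 <= m by rewrite /m !le_max lexx orbT.
  have m3 : log_mgf t - g <= m by rewrite /m !le_max lexx orbT.
  by exists ((m + log_mgf t) / 2); split; lra.
have tl1 : ln (2 * (x - h)) <= t by rewrite ler_ln ?posrE ?mulr_gt0 //; lra.
have tl2 : t <= ln (2 * (x + h)) by rewrite ler_ln ?posrE ?mulr_gt0 //; lra.
pose B1 := [set y : R | x + h <= y]; pose B2 := [set y : R | y <= x - h].
have hB1 y : B1 y -> (t - ln (2 * (x + h))) * y <= (t - ln (2 * (x + h))) * (x + h).
  by move=> hy; rewrite ler_wnM2l // subr_le0.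
have hB2 y : B2 y -> (t - ln (2 * (x - h))) * y <= (t - ln (2 * (x - h))) * (x - h).
  by move=> hy; rewrite ler_wpM2l // subr_ge0.
have H1 := near_tilted_prob_le hB1 d1 (@ltr01 R).
have H2 := near_tilted_prob_le hB2 d2 (@ltr01 R).
have H3 := near_cycle_mgf_ge d3 (ltr0Sn R 2).
pose b1 n (p : parking n) := `[< B1 (cycles_over_log R p) >].
pose b2 n (p : parking n) := `[< B2 (cycles_over_log R p) >].
pose bB n (p : parking n) := `[< B (cycles_over_log R p) >].
near=> n.
have L0 : 0 < speed n by apply: lt_le_trans ltr01 _; near: n; exact: near_speed.
have e1 : tilted_prob t (@b1 n) <= 1 * expR (d * speed n).
  by near: n.
have e2 : tilted_prob t (@b2 n) <= 1 * expR (d * speed n).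
  by near: n.
have e3 : 3 * expR (d * speed n) <= cycle_mgf n t.
  by near: n.
pose c := (t * x + `|t| * h) * speed n.
have e4 : cycle_mgf n t <= expR c * prob (@bB n) + (tilted_prob t (@b1 n) + tilted_prob t (@b2 n)).
  rewrite -meanZ -!meanD; apply: mean_le => p.
  have [p1|p1] := leP (x + h) (cycles_over_log R p).
    have -> : b1 n p by apply/asboolP.
    by rewrite mulr1 addrCA lerDl addr_ge0 // mulr_ge0 ?expR_ge0.
  have [p2|p2] := leP (cycles_over_log R p) (x - h).
    have -> : b2 n p by apply/asboolP.
    by rewrite mulr1 addrA lerDr addr_ge0 // mulr_ge0 ?expR_ge0.
  have -> : bB n p.
    apply/asboolP; apply: eB; rewrite /ball /= ltr_norml; apply/andP; split; lra.
  rewrite mulr1; apply: (@le_trans _ _ (expR c)); last first.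
    by rewrite lerDl addr_ge0 // mulr_ge0 ?expR_ge0.
  rewrite ler_expR (parking_cyclesE p L0) mulrA ler_wpM2r ?(ltW L0) //.
  have : `|t * (cycles_over_log R p - x)| <= `|t| * h.
    rewrite normrM ler_wpM2l // ler_norml; apply/andP; split; lra.
  by rewrite ler_norml => /andP[_]; lra.
have e5 : expR (d * speed n) <= expR c * prob (@bB n) by lra.
rewrite -[prob _]/(prob (@bB n)) -(ler_pM2l (expR_gt0 c)); apply: le_trans e5.
rewrite -expRD ler_expR /c -mulrDl ler_wpM2r ?(ltW L0) //.
have rx : rate x = x * t - log_mgf t by exact: rateE.
have gE : 2 * g = - rate x - b by rewrite /g; lra.
by clear -d4 hg rx gE; lra.
Unshelve. all: by end_near. Qed.
End Tilting.

(** * The large deviation principle *)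

Section LargeDeviations.
Local Open Scope ring_scope.
Variable R : realType.
Implicit Types (x a : R) (B : set R).

Lemma limn_esup_le_near (u : (\bar R)^nat) (l : \bar R) :
  (\forall n \near \oo, (u n <= l)%E) -> (limn_esup u <= l)%E.
Proof.
move=> ul; apply: ge_ereal_inf; exists (ereal_sup (u @` [set n | (u n <= l)%E])).
  by exists [set n | (u n <= l)%E].
by apply: ge_ereal_sup => _ [n /= h <-].
Qed.

Lemma limn_einf_ge_near (u : (\bar R)^nat) (l : \bar R) :
  (\forall n \near \oo, (l <= u n)%E) -> (l <= limn_einf u)%E.
Proof.
move=> lu; rewrite /limn_einf leeNr; apply: limn_esup_le_near.
by apply: filterS lu => n /=; rewrite leeN2.
Qed.

Lemma lee_real_below (c d : \bar R) :
  (forall a, (a%:E < c)%E -> (a%:E <= d)%E) -> (c <= d)%E.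
Proof.
case: c => [r| |] h; last by rewrite leNye.
  by apply/lee_subgt0Pr => e e0; apply: h; rewrite lte_fin ltrBlDr ltrDl.
suff -> : d = +oo%E by [].
by apply/eqyP => A _; apply: h; rewrite ltry.
Qed.

Definition prob_in n B : R :=
  prob R (fun p : parking n => `[< B (cycles_over_log R p) >]).

Lemma prob_in0 n : prob_in n set0 = 0.
Proof.
rewrite /prob_in /prob /mean big1 ?mul0r // => p _.
by rewrite (_ : `[< _ >] = false) //; apply/asboolPn.
Qed.

Lemma log_prob_le n B a : 0 < speed R n -> prob_in n B <= expR (- a * speed R n) ->
  ((speed R n)^-1%:E * lne (prob_in n B)%:E <= (- a)%:E)%E.
Proof.
move=> L0 h /=; case: ifPn => [_|]; first by rewrite mulrNy gtr0_sg ?invr_gt0 // mul1e leNye.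
rewrite -ltNge => p0; rewrite -EFinM lee_fin mulrC ler_pdivrMr //.
by rewrite -ler_expR lnK.
Qed.

Lemma log_prob_ge n B b : 0 < speed R n -> expR (b * speed R n) <= prob_in n B ->
  (b%:E <= (speed R n)^-1%:E * lne (prob_in n B)%:E)%E.
Proof.
move=> L0 h; have p0 := lt_le_trans (expR_gt0 _) h.
rewrite lne_EFin // -EFinM lee_fin mulrC ler_pdivlMr //.
by rewrite -ler_expR lnK.
Qed.

Lemma prob_in_uniform n (d : measure_display) (T : measurableType d)
    (P : probability T R) (X : {RV P >-> parking n}) B :
  uniform_parking X ->
  P ((@cycles_over_log R n \o X) @^-1` B) = (prob_in n B)%:E.
Proof.
move=> hX; pose b (p : parking n) := `[< B (cycles_over_log R p) >].
have -> : (@cycles_over_log R n \o X) @^-1` B = \bigcup_(p in [set` b]) X @^-1` [set p].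
  apply/seteqP; split => [w Bw|w [p /asboolP Bp Xw]].
    by exists (X w) => //; apply/asboolP.
  by rewrite /= Xw.
rewrite measure_fin_bigcup //; last first.
- move=> p _; have := @measurable_funPT _ _ _ _ X measurableT [set p] I.
  by rewrite setTI.
- exact: trivIset_preimage1.
rewrite (eq_fsbigr (fun=> (#|{: parking n}|%:R^-1)%:E)) => [|p _]; last exact: hX.
rewrite (fsbigE (enum b)) ?enum_uniq //; last 2 first.
- by move=> p; rewrite /= mem_enum.
- by move=> p /= bp /negP[]; rewrite mem_enum.
rewrite sumEFin /prob_in /prob /mean; congr (_%:E).
rewrite mulr_suml big_enum_cond /= [RHS](eq_bigr (fun p => if b p then #|{: parking n}|%:R^-1 else 0)).
  rewrite -big_mkcond; apply: eq_bigl => p.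
  by rewrite mem_setE andbb.
by move=> p _; rewrite -/(b p); case: (b p); rewrite ?mul1r ?mul0r.
Qed.

(** Chernoff's bound for the half-line that starts at the smallest point of [G]. *)
Lemma near_prob_ge_half G a : closed G -> (forall x, G x -> 2^-1 <= x) ->
  (forall x, G x -> (a%:E < cycle_rate x)%E) ->
  \forall n \near \oo, prob_in n G <= 2^-1 * expR (- a * speed R n).
Proof.
move=> cG G2 Ga; have [->|/set0P[z Gz]] := eqVneq G set0.
  by near=> n; rewrite prob_in0 mulr_ge0 ?expR_ge0.
have lbG : has_lbound G by exists 2^-1 => x /G2.
have Gi : G (inf G).
  suff : closure G (inf G) by rewrite -(closure_id G).1.
  move=> V /nbhs_ballP[e /= e0 eV].
  have [y Gy ye] := inf_adherent e0 (conj (ex_intro _ z Gz) lbG).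
  exists y; split=> //; apply: eV.
  have iy : inf G <= y by exact: ge_inf.
  by rewrite /ball /= ler0_norm; lra.
have [t t0 ta] := cycle_rate_gt_right (G2 _ Gi) (Ga _ Gi).
have hG y : G y -> (0 - t) * y <= (0 - t) * inf G.
  by move=> Gy; rewrite ler_wnM2l ?sub0r ?oppr_le0 // ge_inf.
have hb : (0 - t) * inf G + log_mgf t < - a by lra.
have := near_tilted_prob_le hG hb (c := 2^-1); rewrite invr_gt0 => /(_ (ltr0Sn _ _)).
by apply: filterS => n; rewrite tilted_prob0.
Unshelve. all: by end_near. Qed.

(** Chernoff's bound for the half-line that ends at the largest point of [G]. *)
Lemma near_prob_le_half G a : closed G -> (forall x, G x -> x <= 2^-1) ->
  (forall x, G x -> (a%:E < cycle_rate x)%E) ->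
  \forall n \near \oo, prob_in n G <= 2^-1 * expR (- a * speed R n).
Proof.
move=> cG G2 Ga; have [->|/set0P[z Gz]] := eqVneq G set0.
  by near=> n; rewrite prob_in0 mulr_ge0 ?expR_ge0.
have ubG : has_ubound G by exists 2^-1 => x /G2.
have Gs : G (sup G).
  suff : closure G (sup G) by rewrite -(closure_id G).1.
  by apply: closure_sup => //; exists z.
have [t t0 ta] := cycle_rate_gt_left (G2 _ Gs) (Ga _ Gs).
have hG y : G y -> (0 - t) * y <= (0 - t) * sup G.
  by move=> Gy; rewrite ler_wpM2l ?sub0r ?oppr_ge0 // ub_le_sup.
have hb : (0 - t) * sup G + log_mgf t < - a by lra.
have := near_tilted_prob_le hG hb (c := 2^-1); rewrite invr_gt0 => /(_ (ltr0Sn _ _)).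
by apply: filterS => n; rewrite tilted_prob0.
Unshelve. all: by end_near. Qed.

(** Cut the closed set at [1/2], where the rate vanishes. *)
Lemma near_prob_in_closed F a : closed F ->
  (forall x, F x -> (a%:E < cycle_rate x)%E) ->
  \forall n \near \oo, prob_in n F <= expR (- a * speed R n).
Proof.
move=> cF Fa.
have Hr : \forall n \near \oo,
    prob_in n (F `&` [set x | 2^-1 <= x]) <= 2^-1 * expR (- a * speed R n).
  apply: near_prob_ge_half => [|x []//|x [/Fa]//].
  by apply: closedI => //; exact: closed_ge.
have Hl : \forall n \near \oo,
    prob_in n (F `&` [set x | x <= 2^-1]) <= 2^-1 * expR (- a * speed R n).
  apply: near_prob_le_half => [|x []//|x [/Fa]//].
  by apply: closedI => //; exact: closed_le.
apply: filterS2 Hr Hl => n hr hl.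
suff : prob_in n F <= prob_in n (F `&` [set x | 2^-1 <= x]) +
    prob_in n (F `&` [set x | x <= 2^-1]) by lra.
rewrite -meanD; apply: mean_le => p.
case: (asboolP (F _)) => [Fp|_]; last by rewrite addr_ge0.
case/orP: (le_total 2^-1 (cycles_over_log R p)) => h.
  by rewrite (_ : `[< _ >]) ?lerDl //; apply/asboolP.
by rewrite addrC (_ : `[< _ >]) ?lerDl //; apply/asboolP.
Qed.

Lemma prob_in_subset n A B : A `<=` B -> prob_in n A <= prob_in n B.
Proof.
move=> AB; apply: mean_le => p; case: asboolP => // /AB Bp.
by rewrite (_ : `[< _ >]) //; apply/asboolP.
Qed.

Lemma limn_einf_ge_rate B x : 0 <= x -> nbhs x B ->
  (- cycle_rate x <= limn_einf (fun n => (speed R n)^-1%:E * lne (prob_in n B)%:E))%E.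
Proof.
have pos (z : R) : 0 < z -> nbhs z B ->
    (- cycle_rate z <= limn_einf (fun n => (speed R n)^-1%:E * lne (prob_in n B)%:E))%E.
  move=> z0 Bz; apply/lee_subgt0Pr => e e0; rewrite (cycle_rateE (ltW z0)).
  apply: limn_einf_ge_near.
  have hb : - rate z - e < - rate z by rewrite gtrBl.
  have := near_prob_ge z0 Bz hb.
  have := near_speed (1 : R); apply: filterS2 => n L1 h.
  by apply: (@log_prob_ge _ _ (- rate z - e)) => //; apply: lt_le_trans ltr01 L1.
rewrite le_eqVlt => /orP[/eqP <- B0|]; last exact: pos.
have [e /= e0 eB] := (nbhs_ballP _ _).1 B0.
pose z : R := Num.min (e / 2) 2^-1.
have z0 : 0 < z by rewrite lt_min divr_gt0 //= invr_gt0.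
have ze : z < e by apply: (@le_lt_trans _ _ (e / 2)); [rewrite ge_min lexx|lra].
apply: le_trans (pos z z0 _).
  by rewrite leeN2 cycle_rate_0_max ?(ltW z0) // ge_min lexx orbT.
apply: filterS eB _; apply: open_nbhs_nbhs; split; first exact: ball_open.
by rewrite /ball /= sub0r normrN gtr0_norm.
Qed.
End LargeDeviations.

Theorem theorem4p3 (R : realType) (d : nat -> measure_display)
    (T : forall n : nat, measurableType (d n))
    (P : forall n : nat, probability (T n) R)
    (pi_ : forall n : nat, {RV P n >-> parking n})
    (pi_uniform : forall n : nat, uniform_parking (pi_ n)) :
  large_deviation_principle (P := P)
    (fun n : nat => @cycles_over_log R n \o pi_ n)
    (fun n : nat => ln n%:R)
    (@cycle_rate R).
Proof.
split.
- exact: cvg_speed.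
- exact: cycle_rate_ge0.
- exact: lower_semicontinuous_cycle_rate.
move=> B mB u.
have -> : u = (fun n => (speed R n)^-1%:E * lne (prob_in n B)%:E)%E.
  by apply/funext => n; rewrite /u prob_in_uniform.
split; [|split; first exact: limn_einf_sup].
  rewrite leeNl; apply: le_ereal_inf_tmp => _ [x Bx <-]; rewrite leeNl.
  have [x0|x0] := leP 0 (x : R); first exact: limn_einf_ge_rate.
  by rewrite /cycle_rate (lt_geF x0); exact: leNye.
rewrite leeNr; apply: lee_real_below => a ha; rewrite leeNr.
apply: limn_esup_le_near.
have Fa x : closure B x -> (a%:E < cycle_rate x)%E.
  by move=> Bx; apply: lt_le_trans ha _; apply: ereal_inf_lbound; exists x.
have := near_prob_in_closed (@closed_closure _ B) Fa.
have := near_speed (1 : R); apply: filterS2 => n L1 h.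
apply: log_prob_le; first exact: lt_le_trans ltr01 L1.
by apply: le_trans h; apply: prob_in_subset; exact: subset_closure.
Qed.
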